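(* Let $(x,0),(x,u)\in\mathbb{R}^n\times\mathbb{R}$ with $x\neq0$ and $u>0$. Put $\hat\mu(s)=\frac{s}{\cos^2s}+\tan s$ for $s\in\mathbb{R}\setminus\{(k+\frac12)\pi:k\in\mathbb{Z}\}$. There are finitely many geodesics connecting $(x,0)$ and $(x,u)$. Namely: 1. For any solution $b$ of $$\frac{u}{|x|^2}=\hat\mu\left(\frac b2\right)$$ there is a geodesic $\gamma^b$ with square of length $$L(\gamma^b)^2=\frac{b^2}{\cos^2\frac b2}|x|^2=2bu-2|x|^2b\tan\frac b2,$$ which strictly increases with $b$. 2. If $u\ge|x|^2\pi$, then for each integer $m\ge1$ with $u\ge m\pi|x|^2$ there are geodesics $\gamma^{b,c}$ with $b=2m\pi$, $|c|=2\sqrt{m\pi u-(m\pi)^2|x|^2}$, with lengths $$L(\gamma^{b,c})=2\sqrt{m\pi u}.$$ Moreover, the shortest geodesic, and therefore the Carnot–Carathéodory distance, is given by the unique solution $b$ of $\frac{u}{|x|^2}=\hat\mu\left(\frac b2\right)$ in the interval $(0,\pi)$; with this $b$ we have $$d_{CC}\left((x,0),(x,u)\right)=\frac{b}{\cos\frac b2}|x|=\sqrt{2bu-2|x|^2b\tan\frac b2}.$$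
   Context: On $\mathbb{R}^{n+1}=\mathbb{R}^n_x\times\mathbb{R}_u$ consider the vector fields $X_j=\partial_{x_j}$, $U_j=x_j\partial_u$ ($j=1,\dots,n$). For $p\in\mathbb{R}^{n+1}$ and a tangent vector $v$ at $p$ put $\|v\|_p^2=\inf\{\sum_{j=1}^n(\alpha_j^2+\beta_j^2): v=\sum_{j=1}^n(\alpha_jX_j(p)+\beta_jU_j(p))\}$, with $\inf\varnothing=\infty$. A horizontal curve is an absolutely continuous curve $\gamma:[0,1]\to\mathbb{R}^{n+1}$ with $\dot\gamma(t)\in\mathrm{span}\{X_j(\gamma(t)),U_j(\gamma(t)):1\le j\le n\}$ for almost every $t$; its length is $L(\gamma)=\int_0^1\|\dot\gamma(t)\|_{\gamma(t)}\,dt$. The Carnot–Carathéodory distance $d_{CC}(p,q)$ is the infimum of $L(\gamma)$ over all horizontal curves $\gamma$ with $\gamma(0)=p$, $\gamma(1)=q$. Geodesics are the solutions of the Euler–Lagrange equations of the energy $\int_0^1\|\dot\gamma\|_\gamma^2dt$. The geodesics starting at $(x_1,0)$ are the curves $\gamma^{b,c}=(\gamma^{b,c}_{(1)},\gamma^{b,c}_{(2)}):[0,1]\to\mathbb{R}^n\times\mathbb{R}$ with parameters $b\in\mathbb{R}$, $c\in\mathbb{R}^n$, where for $b\neq0$ $$\gamma^{b,c}_{(1)}(t)=\frac cb\sin(bt)+x_1\cos(bt),$$ $$\gamma^{b,c}_{(2)}(t)=\frac{|c|^2}{b}\left(\frac t2-\frac{\sin(2bt)}{4b}\right)+\frac{x_1\cdot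 c}{b}\sin^2(bt)+|x_1|^2b\left(\frac t2+\frac{\sin(2bt)}{4b}\right),$$ and $\gamma^{0,c}(t)=(ct+x_1,0)$. Their length is $L(\gamma^{b,c})=\sqrt{|c|^2+|x_1|^2b^2}$. Here $x_1=x$, and a geodesic connects $(x,0)$ and $(x,u)$ if $\gamma^{b,c}(1)=(x,u)$. When $b$ is not a nonzero integer multiple of $\pi$, the endpoint condition determines $c$ uniquely, namely $c=\frac{b}{\sin b}(x-x\cos b)=b\tan\left(\frac b2\right)x$, and $\gamma^b$ denotes the geodesic $\gamma^{b,c}$ with this $c$ (where $b$ is an even multiple of $\pi$, $c=b\tan\left(\frac b2\right)x=0$).
   Formalization: ''Finitely many geodesics'' fails for n ≥ 2 and u > π|x|² (item 2 gives a sphere of vectors c); the formal theorem asserts finitely many geodesics only if n = 1 or u ≤ π|x|², and in all cases finitely many values of b and of the length, with the full enumeration. *)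

(* Defs.v *)
From HB Require Import structures.
From mathcomp Require Import all_boot all_order all_algebra.
From mathcomp Require Import all_classical all_reals all_analysis.
Set Implicit Arguments.
Unset Strict Implicit.
Unset Printing Implicit Defensive.
Import Order.TTheory GRing.Theory Num.Theory.
Import numFieldNormedType.Exports.
Local Open Scope classical_set_scope.
Local Open Scope ring_scope.

(* The library norm on 'rV_n is the sup norm, hence the explicit Euclidean
   inner product and norm. *)
Definition dot (R : realType) (n : nat) (x y : 'rV[R]_n) : R :=
  \sum_(j < n) x 0 j * y 0 j.

Definition enorm (R : realType) (n : nat) (x : 'rV[R]_n) : R :=
  Num.sqrt (dot x x).


(* Points of R^n_x * R_u and tangent vectors are both pairs in 'rV_n * R. *)
Definition pairing (R : realType) (n : nat) (p w : 'rV[R]_n * R) : R :=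
  dot p.1 w.1 + p.2 * w.2.

Definition Xfield (R : realType) (n : nat) (j : 'I_n) (p : 'rV[R]_n * R) :
  'rV[R]_n * R := (delta_mx 0 j, 0).

Definition Ufield (R : realType) (n : nat) (j : 'I_n) (p : 'rV[R]_n * R) :
  'rV[R]_n * R := (0, p.1 0 j).

Definition field_comb (R : realType) (n : nat) (p : 'rV[R]_n * R)
    (alpha beta : 'I_n -> R) : 'rV[R]_n * R :=
  \sum_(j < n) (alpha j *: Xfield j p + beta j *: Ufield j p).

Definition horizontal_vector (R : realType) (n : nat) (p v : 'rV[R]_n * R) :
  Prop := exists alpha beta : 'I_n -> R, v = field_comb p alpha beta.

(* ereal_inf set0 = +oo *)
Definition hnorm_sq (R : realType) (n : nat) (p v : 'rV[R]_n * R) : \bar R :=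
  ereal_inf [set e : \bar R | exists alpha beta : 'I_n -> R,
    v = field_comb p alpha beta /\
    e = (\sum_(j < n) (alpha j ^+ 2 + beta j ^+ 2))%:E].

Definition hnorm (R : realType) (n : nat) (p v : 'rV[R]_n * R) : \bar R :=
  sqrte (hnorm_sq p v).

(* The sup norm of 'rV_n * R is used here; any other norm on R^(n+1) gives the
   same notion. *)
Definition abs_continuous01 (R : realType) (n : nat)
    (g : R -> 'rV[R]_n * R) : Prop :=
  forall eps : R, 0 < eps -> exists2 delta : R, 0 < delta &
    forall (k : nat) (a b : 'I_k -> R),
      (forall i, [/\ 0 <= a i, a i <= b i & b i <= 1]) ->
      trivIset [set: 'I_k] (fun i => `]a i, b i[%classic) ->
      \sum_(i < k) (b i - a i) < delta ->
      \sum_(i < k) `|g (b i) - g (a i)| < eps.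

(* Curves are total functions on R of which only the restriction to [0, 1]
   matters. *)
Definition horizontal_curve (R : realType) (n : nat)
    (g : R -> 'rV[R]_n * R) : Prop :=
  abs_continuous01 g /\
  {ae lebesgue_measure, forall t : R, t \in `[0, 1] ->
    derivable g t 1 /\ horizontal_vector (g t) ('D_1 g t)}.

Definition clength (R : realType) (n : nat) (g : R -> 'rV[R]_n * R) : \bar R :=
  (\int[lebesgue_measure]_(t in `[0%R, 1%R]%classic) hnorm (g t) ('D_1 g t))%E.

Definition connects (R : realType) (n : nat) (p q : 'rV[R]_n * R)
    (g : R -> 'rV[R]_n * R) : Prop := g 0 = p /\ g 1 = q.

Definition dCC (R : realType) (n : nat) (p q : 'rV[R]_n * R) : \bar R :=
  ereal_inf [set l : \bar R | exists g : R -> 'rV[R]_n * R,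
    [/\ horizontal_curve g, connects p q g & l = clength g]].

Definition lagrangian (R : realType) (n : nat) (q v : 'rV[R]_n * R) : R :=
  fine (hnorm_sq q v).

(* Euler-Lagrange equations of the energy \int_0^1 lagrangian g g',
     d/dt (D_v lagrangian) = D_q lagrangian,
   written with the conjugate momentum P = D_v lagrangian.
   The Lagrangian is infinite at nonhorizontal vectors over {x = 0}, so the
   equations only make sense where g does not meet {x = 0}; since geodesics may
   cross {x = 0}, the momentum is required to extend differentiably through
   the crossing times. (Otherwise pieces of unrelated solutions
   could be concatenated at a crossing.) *)
Definition is_geodesic (R : realType) (n : nat)
    (g : R -> 'rV[R]_n * R) : Prop :=
  horizontal_curve g /\
  exists P : R -> 'rV[R]_n * R, forall t : R, 0 < t < 1 ->
    [/\ derivable g t 1, derivable P t 1 &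
      (g t).1 != 0 -> forall w : 'rV[R]_n * R,
        pairing (P t) w = 'D_w (fun v => lagrangian (g t) v) ('D_1 g t) /\
        pairing ('D_1 P t) w = 'D_w (fun q => lagrangian q ('D_1 g t)) (g t)].

Definition geod (R : realType) (n : nat) (x1 : 'rV[R]_n) (b : R)
    (c : 'rV[R]_n) (t : R) : 'rV[R]_n * R :=
  if b == 0 then (t *: c + x1, 0) else
  ((sin (b * t) / b) *: c + cos (b * t) *: x1,
   enorm c ^+ 2 / b * (t / 2 - sin (2 * b * t) / (4 * b))
   + dot x1 c / b * sin (b * t) ^+ 2
   + enorm x1 ^+ 2 * b * (t / 2 + sin (2 * b * t) / (4 * b))).

(* The curve gamma^b; meaningful when cos (b / 2) != 0. *)
Definition geodb (R : realType) (n : nat) (x : 'rV[R]_n) (b : R) :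
  R -> 'rV[R]_n * R := geod x b ((b * tan (b / 2)) *: x).

Definition muhat (R : realType) (s : R) : R := s / cos s ^+ 2 + tan s.

(* b solves u / |x|^2 = muhat (b / 2), including that b / 2 lies in the domain
   of muhat. *)
Definition mu_solution (R : realType) (n : nat) (x : 'rV[R]_n) (u b : R) :
  Prop := cos (b / 2) != 0 /\ u / enorm x ^+ 2 = muhat (b / 2).

(* Main.v *)
(* A geodesic issued from (x, 0) with x <> 0 has a constant vertical momentum 2b,
   and its first component solves g1'' = - b^2 g1. It can only cross {x = 0} at
   isolated times, because (g1, g1') never vanishes, and the continuity of the
   momentum identifies the solutions on both sides. Evaluating at time 1
   leaves two cases: either sin b <> 0, which determines c and turns the vertical
   condition into the equation for b, or b = 2 m pi and only |c| is prescribed.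

   For the distance, let a solve the Riccati equation a' = - b^2 - a^2 on [0, 1],
   which is possible because b < pi, and let th be the arc length of a horizontal
   curve divided by a number L larger than its length. Completing squares shows
   that 2 b g2 + a(th) |g1|^2 - L^2 th has a nonpositive derivative almost
   everywhere along the curve; since its increments are bounded above by those of
   an absolutely continuous curve, it does not increase, and comparing
   its values at 0 and 1 gives
   2 b u - 2 |x|^2 b tan (b / 2) <= L^2. *)
Require Import Defs.
From HB Require Import structures.
From mathcomp Require Import all_boot all_order all_algebra.
From mathcomp Require Import all_classical all_reals all_analysis.
From mathcomp Require Import measurable_realfun.
From mathcomp Require Import ring lra.
Set Implicit Arguments.
Unset Strict Implicit.
Unset Printing Implicit Defensive.
Import Order.TTheory GRing.Theory Num.Theory.
Import numFieldNormedType.Exports.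
Local Open Scope classical_set_scope.
Local Open Scope ring_scope.

(** The Riccati equation makes [2 b u + a |x|^2] a solution of the Hamilton-Jacobi equation of the
    energy; its solution [a] stays finite on an interval of length 1 only when [b < pi]. Arc length
    replaces time because the bound concerns the length of a curve of arbitrary parametrization, not
    its energy, and the division by [L] keeps the new time in [0, 1], where [a] is regular. Both
    [a(th)] and [- L^2 th] are nonincreasing, so only the increments of the curve itself can push
    the calibration upwards. Such a one-sided bound is enough for a covering argument:
    differentiability controls the intervals around good points, absolute continuity those around a
    null set. Finiteness and the order of the lengths rest on two identities:
    [(s tan s)' = muhat s], by which [muhat] has at most one critical point on the positive part of
    each branch, and [(s^2 / cos^2 s)' = s * muhat' s]. *)

Section derivation_rules.
Context {R : realType}.
Implicit Types (f g : R -> R) (x a b : R).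

Lemma is_derive_funC x a : is_derive x 1 (fun=> a) 0.
Proof. exact: is_derive_cst. Qed.

Lemma is_derive_funid x : is_derive x 1 (fun t : R => t) 1.
Proof. exact: is_derive_id. Qed.

Lemma is_derive_funD f g x a b : is_derive x 1 f a -> is_derive x 1 g b ->
  is_derive x 1 (fun t => f t + g t) (a + b).
Proof. by move=> fa gb; exact: (@is_deriveD _ _ _ f g). Qed.

Lemma is_derive_funN f x a : is_derive x 1 f a ->
  is_derive x 1 (fun t => - f t) (- a).
Proof. by move=> fa; exact: (@is_deriveN _ _ _ f). Qed.

Lemma is_derive_funM f g x a b : is_derive x 1 f a -> is_derive x 1 g b ->
  is_derive x 1 (fun t => f t * g t) (f x * b + g x * a).
Proof. by move=> fa gb; exact: (@is_deriveM _ _ f g). Qed.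

Lemma is_derive_funX f n x a : is_derive x 1 f a ->
  is_derive x 1 (fun t => f t ^+ n.+1) (n.+1%:R * f x ^+ n * a).
Proof.
by move=> fa; have := @is_deriveX _ _ f n.+1 _ _ _ fa; rewrite exprfctE.
Qed.

Lemma is_derive_funV f x a : f x != 0 -> is_derive x 1 f a ->
  is_derive x 1 (fun t => (f t)^-1) (- a / f x ^+ 2).
Proof.
move=> fx0 fa; apply: DeriveDef; first exact: derivableV.
rewrite deriveV// derive_val/= /GRing.scale/=; field.
exact: fx0.
Qed.

Lemma is_derive_funsin f x a : is_derive x 1 f a ->
  is_derive x 1 (fun t => sin (f t)) (cos (f x) * a).
Proof. by move=> fa; exact: (@is_derive1_comp _ (@sin R) f). Qed.

Lemma is_derive_funcos f x a : is_derive x 1 f a ->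
  is_derive x 1 (fun t => cos (f t)) (- sin (f x) * a).
Proof. by move=> fa; exact: (@is_derive1_comp _ (@cos R) f). Qed.

Lemma is_derive_continuous f x a : is_derive x 1 f a -> {for x, continuous f}.
Proof.
move=> fa; apply: differentiable_continuous.
by apply/derivable1_diffP; exact: ex_derive.
Qed.

Lemma is_derive_within_continuous f df a b :
  (forall x, a <= x <= b -> is_derive x 1 f (df x)) ->
  {within `[a, b], continuous f}.
Proof.
move=> fab; apply: derivable_within_continuous => x.
by rewrite in_itv/= => /fab [].
Qed.

Lemma MVT_is_derive f df a b : a < b ->
  (forall x, a <= x <= b -> is_derive x 1 f (df x)) ->
  exists2 c, a < c < b & f b - f a = df c * (b - a).
Proof.
move=> ab fab; have [|c] := @MVT R f df a b ab _ (is_derive_within_continuous fab).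
  by move=> x; rewrite in_itv/= => /andP[/ltW ax /ltW xb]; apply: fab; rewrite ax.
by rewrite in_itv/= => acb fE; exists c.
Qed.

Lemma is_derive_incr f df a b : a < b ->
  (forall x, a <= x <= b -> is_derive x 1 f (df x)) ->
  (forall x, a < x < b -> 0 < df x) -> f a < f b.
Proof.
move=> ab fab df0; have [c acb fE] := MVT_is_derive ab fab.
by rewrite -subr_gt0 fE mulr_gt0 ?df0// subr_gt0.
Qed.

End derivation_rules.

(* Bypassing type class resolution keeps the derivatives in [fun] form. *)
Ltac der_step := first
  [ match goal with H : is_derive _ _ _ _ |- _ => exact H end
  | notypeclasses refine (is_derive_funC _ _)
  | notypeclasses refine (is_derive_funid _)
  | notypeclasses refine (is_derive_funD _ _)
  | notypeclasses refine (is_derive_funN _)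
  | notypeclasses refine (is_derive_funM _ _)
  | notypeclasses refine (is_derive_funX _ _)
  | notypeclasses refine (is_derive_funsin _)
  | notypeclasses refine (is_derive_funcos _)
  | notypeclasses refine (is_derive_funV _ _) ].

Ltac der := notypeclasses refine (is_derive_eq _ _);
  [repeat der_step; try assumption|rewrite /=].

(** * The function [muhat] and its level sets *)

Section muhat.
Context {R : realType}.
Implicit Types (s t mu : R).

Lemma muhatE s : cos s != 0 -> muhat s = (s + sin s * cos s) / cos s ^+ 2.
Proof. by move=> cs; rewrite /muhat /tan; field. Qed.

Lemma muhatN s : muhat (- s) = - muhat s.
Proof. by rewrite /muhat cosN tanN; ring. Qed.

Lemma norm_sinMcos s : `|sin s * cos s| <= 1 / 2.
Proof. 
rewrite ler_norml; have := cos2Dsin2 s.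
by have := sqr_ge0 (sin s + cos s); have := sqr_ge0 (sin s - cos s); nra.
Qed.

Lemma addr_sinMcos_gt0 s : 0 < s -> 0 < s + sin s * cos s.
Proof.
move=> s0; have := norm_sinMcos s; rewrite ler_norml => /andP[sc _].
have [s1|s1] := ltP (1 / 2) s; first lra.
have pi1 := pihalf_ge1 R.
have : 0 < sin s by apply: sin_gt0_pihalf; lra.
have : 0 < cos s by apply: cos_gt0_pihalf; lra.
nra.
Qed.

Lemma muhat_gt0 s : cos s != 0 -> (0 < muhat s) = (0 < s).
Proof.
have pos t : cos t != 0 -> 0 < t -> 0 < muhat t.
  by move=> ct t0; rewrite muhatE// divr_gt0 ?addr_sinMcos_gt0// exprn_even_gt0.
move=> cs; have [s0|s0|s0] := ltgtP 0 s; first by rewrite pos.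
  apply/negbTE; rewrite -leNgt -oppr_ge0 -muhatN ltW// pos ?cosN//.
  by rewrite oppr_gt0.
by rewrite /muhat -s0 tan0 mul0r addr0.
Qed.

(** Linear growth bounds the solutions at a given level, hence the number of branches of [muhat]
    that can contain one. *)
Lemma muhat_ge s : cos s != 0 -> 0 < s -> s - 1 / 2 <= muhat s.
Proof.
move=> cs s0; have [s1|s1] := leP s (1 / 2).
  by apply: (@le_trans _ _ 0); [lra|rewrite ltW// muhat_gt0].
have := norm_sinMcos s; rewrite ler_norml => /andP[sc _].
have c0 : 0 < cos s ^+ 2 by rewrite exprn_even_gt0.
have c1 : cos s ^+ 2 <= 1 by rewrite cos2sin2; have := sqr_ge0 (sin s); lra.
rewrite muhatE// ler_pdivlMr//; nra.
Qed.

Lemma is_derive_muhat s : cos s != 0 ->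
  is_derive s 1 (@muhat R) (2 * (1 + s * tan s) / cos s ^+ 2).
Proof.
move=> cs.
rewrite (_ : @muhat R = fun s => s * (cos s ^+ 2)^-1 + sin s * (cos s)^-1)//.
der; first by rewrite expf_neq0.
by rewrite /tan; field: (sin2cos2 s).
Qed.

(** The zeros of this function are the critical points of [muhat]. Its derivative [muhat s] is
    positive for [s > 0], so a branch has at most one of them there. *)
Lemma is_derive_1DidMtan s : cos s != 0 ->
  is_derive s 1 (fun t : R => 1 + t * tan t) (muhat s).
Proof.
move=> cs; rewrite /tan; der => //.
by rewrite /muhat /tan; field: (sin2cos2 s).
Qed.

(** The derivative is written as [s] times that of [muhat], so that subtracting [sg * muhat] leaves
    the factor [s - sg]. *)
Lemma is_derive_sqr_div_cos2 s : cos s != 0 ->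
  is_derive s 1 (fun t : R => t ^+ 2 / cos t ^+ 2)
    (s * (2 * (1 + s * tan s) / cos s ^+ 2)).
Proof.
move=> cs; der; first by rewrite expf_neq0.
by rewrite /tan; field.
Qed.

Lemma lt_1DidMtan s t : 0 < s -> s < t ->
  (forall r, s <= r <= t -> cos r != 0) -> 1 + s * tan s < 1 + t * tan t.
Proof.
move=> s0 st crt; have := @is_derive_incr R (fun t : R => 1 + t * tan t) (@muhat R) _ _ st.
apply.
  by move=> r /crt; exact: is_derive_1DidMtan.
by move=> r /andP[sr rt]; rewrite muhat_gt0 ?(lt_trans s0)// crt// !ltW.
Qed.

Lemma muhat_Rolle s t : s < t -> (forall r, s <= r <= t -> cos r != 0) ->
  muhat s = muhat t -> exists2 r, s < r < t & 1 + r * tan r = 0.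
Proof.
move=> st crt mst.
have [r srt] := MVT_is_derive st (fun r srt => is_derive_muhat (crt r srt)).
rewrite mst subrr => /esym/eqP.
have cr : cos r != 0 by case/andP: srt => ? ?; rewrite crt// !ltW.
rewrite mulf_eq0 subr_eq0 (gt_eqF st) orbF mulf_eq0 invr_eq0 expf_eq0/=.
rewrite (negPf cr) orbF mulf_eq0 pnatr_eq0/= => /eqP r0.
by exists r.
Qed.

(* [s^2 / cos^2 s] grows along the level sets of [muhat]: between two points of
   a level set that are not separated by a zero of [cos], subtracting
   [sigma * muhat], with [sigma] a critical point of [muhat], gives an increasing
   function. Otherwise, with [y = s tan s], the points lie on the circle
   [(y + 1/2)^2 + (s - mu/2)^2 = (1 + mu^2)/4] and [s^2 / cos^2 s = s mu - y]. *)
Lemma sqr_div_cos2_lt s t : 0 < s -> s < t -> cos s != 0 -> cos t != 0 ->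
  muhat s = muhat t -> s ^+ 2 / cos s ^+ 2 < t ^+ 2 / cos t ^+ 2.
Proof.
move=> s0 st cs ct mst.
have [crt|] := pselect (forall r, s <= r <= t -> cos r != 0).
  have [sg /andP[ssg sgt] sg0] := muhat_Rolle st crt mst.
  pose G r := r ^+ 2 / cos r ^+ 2 + - sg * muhat r.
  pose dG r := (r - sg) * (2 * (1 + r * tan r) / cos r ^+ 2).
  have dGE r : s <= r <= t -> is_derive r 1 G (dG r).
    move=> /crt cr; rewrite /G.
    have := is_derive_muhat cr; have := is_derive_sqr_div_cos2 cr => d1 d2.
    notypeclasses refine (is_derive_eq (is_derive_funD d1
      (is_derive_funM (is_derive_funC _ _) d2)) _).
    rewrite /dG; ring.
  (* The factors [r - sg] and [1 + r * tan r] change sign together at [sg], the second because it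
     increases. *)
  have dG0 r : s <= r <= t -> r != sg -> 0 < dG r.
    move=> /andP[sr rt] rsg.
    have cr : 0 < cos r ^+ 2 by rewrite exprn_even_gt0//= crt// sr.
    rewrite /dG mulrA divr_gt0// mulrCA mulr_gt0//.
    move: rsg; rewrite neq_lt => /orP[] rsg.
      have : 1 + r * tan r < 1 + sg * tan sg.
        apply: lt_1DidMtan => //; first exact: lt_le_trans sr.
        by move=> q /andP[rq qsg]; apply: crt; rewrite (le_trans sr)// (le_trans qsg)// ltW.
      by rewrite sg0 => ?; rewrite nmulr_rgt0// subr_lt0.
    have : 1 + sg * tan sg < 1 + r * tan r.
      apply: lt_1DidMtan => //; first exact: lt_trans ssg.
      by move=> q /andP[rq qsg]; apply: crt; rewrite (le_trans _ rq) ?(le_trans qsg)// ltW.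
    by rewrite sg0 => ?; rewrite mulr_gt0// subr_gt0.
  have G1 : G s < G sg.
    apply: (is_derive_incr (df := dG)) => // r /andP[sr rsg].
      by apply: dGE; rewrite sr (le_trans rsg)// ltW.
    by apply: dG0; rewrite ?(ltW sr)/= ?(lt_eqF rsg)// (le_trans (ltW rsg))// ltW.
  have G2 : G sg < G t.
    apply: (is_derive_incr (df := dG)) => // r /andP[sr rsg].
      by apply: dGE; rewrite rsg (le_trans _ sr)// ltW.
    by apply: dG0; rewrite ?(ltW rsg)/= ?(gt_eqF sr)// andbT (le_trans (ltW ssg))// ltW.
  have := lt_trans G1 G2.
  by rewrite /G mst ltrD2r.
move=> /existsNP[z /not_implyP[/andP[sz zt] /negP]]; rewrite negbK => /eqP cz.
have {}sz : s < z by rewrite lt_neqAle sz andbT; apply: contra_neq cs => ->.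
have {}zt : z < t by rewrite lt_neqAle zt andbT eq_sym; apply: contra_neq ct => ->.
set mu := muhat s in mst.
have E (r : R) : cos r != 0 -> r ^+ 2 / cos r ^+ 2 = r * (muhat r - tan r).
  by move=> cr; rewrite /muhat addrK; field.
have Q (r : R) : cos r != 0 -> r * (1 + tan r ^+ 2) + tan r = muhat r.
  by move=> cr; rewrite /muhat -cos2_tan2//.
rewrite !E// -mst -/mu.
have t0 := lt_trans s0 st.
have mus : 0 < mu - tan s.
  by rewrite /mu /muhat addrK divr_gt0// exprn_even_gt0.
have mu0 : 0 < mu by rewrite muhat_gt0.
have [tts|tst] := leP (tan t) (tan s).
  by apply: (@lt_le_trans _ _ (t * (mu - tan s))); [rewrite ltr_pM2r|rewrite ler_pM2l ?lerB].
(* If [t - s < pi], then [sin (t - s) > 0] and [tan s < tan t] give [cos s] and [cos t] the same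
   sign, whereas expanding both at the zero [z] of [cos] between them gives opposite signs. *)
have stpi : pi <= t - s.
  rewrite leNgt; apply/negP => stpi.
  have sst : 0 < sin (t - s) by apply: sin_gt0_pi; rewrite subr_gt0 st.
  have : 0 < cos s * cos t.
    have := mulr_gt0 sst (_ : 0 < (tan t - tan s)^-1).
    rewrite invr_gt0 subr_gt0 => /(_ tst).
    suff -> : sin (t - s) = cos s * cos t * (tan t - tan s).
      by rewrite mulfK// gt_eqF// subr_gt0.
    by rewrite sinB /tan; field; rewrite cs ct.
  have -> : s = z - (z - s) by ring.
  have -> : t = z + (t - z) by ring.
  rewrite (cosB z (z - s)) (cosD z (t - z)) cz !mul0r add0r sub0r.
  have := cos2Dsin2 z; rewrite cz expr0n/= add0r.
  have : 0 < sin (z - s) by apply: sin_gt0_pi; lra.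
  have : 0 < sin (t - z) by apply: sin_gt0_pi; lra.
  move: (sin (z - s)) (sin (t - z)) (sin z) => p q w q0 p0 w1.
  by rewrite (_ : _ * _ = - (p * q * w ^+ 2)); [rewrite w1; nra|ring].
have := Q _ cs; have := Q _ ct; rewrite -mst -/mu.
have pi2 := pi_ge2 R.
move: (tan s) (tan t) mus tst => y z' mus tst Ht Hs.
(* The negation gives [yt - ys >= mu * (t - s) >= 2 * mu]. As the circle has squared diameter
   [1 + mu^2], this forces [mu <= 1]; but [t >= 2], so [t - mu / 2 >= 3 / 2] exceeds the radius. *)
rewrite ltNge; apply/negP => H.
pose ys := s * y; pose yt := t * z'.
have Cs : (ys + 1/2) ^+ 2 + (s - mu / 2) ^+ 2 = (1 + mu ^+ 2) / 4.
  by rewrite /ys -Hs; field; rewrite ?pnatr_eq0.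
have Ct : (yt + 1/2) ^+ 2 + (t - mu / 2) ^+ 2 = (1 + mu ^+ 2) / 4.
  by rewrite /yt -Ht; field; rewrite ?pnatr_eq0.
have D : mu * 2 <= yt - ys.
  have := ler_wpM2l (ltW mu0) (le_trans pi2 stpi).
  by rewrite /ys /yt; lra.
clear -Cs Ct D mu0 pi2 stpi s0; clearbody mu ys yt.
have D2 : (yt - ys) ^+ 2 <= 1 + mu ^+ 2.
  have := sqr_ge0 (yt + ys + 1); have := sqr_ge0 (s - mu / 2).
  have := sqr_ge0 (t - mu / 2).
  lra.
have M : (mu * 2) ^+ 2 <= 1 + mu ^+ 2.
  by apply: le_trans D2; rewrite ler_sqr ?nnegrE; lra.
have mu1 : mu <= 1 by nra.
have := sqr_ge0 (yt + 1 / 2).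
have : 3 / 2 <= t - mu / 2 by lra.
move: (t - mu / 2) Ct => v Ct v0 yt0.
have : (3 / 2) ^+ 2 <= v ^+ 2 by rewrite ler_sqr ?nnegrE; lra.
lra.
Qed.

Lemma muhat_surj mu : 0 < mu ->
  exists s, [/\ 0 < s, s < pi / 2, cos s != 0 & muhat s = mu].
Proof.
move=> mu0; have pi2 := pihalf_ge1 R.
(* At [atan mu] the term [tan s] of [muhat] alone already reaches [mu], so [0, atan mu] serves for
   the intermediate value theorem. *)
have a0 : 0 <= atan mu by rewrite -(@atan0 R) le_atan// ltW.
have cr r : 0 <= r <= atan mu -> 0 < cos r.
  move=> /andP[r0 ra]; apply: cos_gt0_pihalf.
  by rewrite (le_lt_trans ra) ?atan_ltpi2// andbT; lra.
have [||s] := @IVT R (@muhat R) 0 (atan mu) mu a0.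
- apply: is_derive_within_continuous => r /cr cr0.
  by apply: is_derive_muhat; rewrite gt_eqF.
- rewrite ge_min le_max {1}/muhat tan0 mul0r addr0 (ltW mu0)/=.
  apply/orP; right; rewrite /muhat atanK lerDr.
  by rewrite divr_ge0 ?sqr_ge0.
rewrite in_itv/= => /andP[s0 sa] smu.
have cs : cos s != 0 by rewrite gt_eqF// cr// s0.
by exists s; rewrite -(muhat_gt0 cs) smu (le_lt_trans sa) ?atan_ltpi2.
Qed.

Lemma muhat_inj s t : 0 < s < pi / 2 -> 0 < t < pi / 2 ->
  muhat s = muhat t -> s = t.
Proof.
wlog: s t / s <= t => [H s0 t0 st|st /andP[s0 sp] /andP[t0 tp] mst].
  by have [/H|/ltW/H] := leP s t; [exact|move=> ->].
apply/eqP; rewrite eq_le st/= leNgt; apply/negP => {}st.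
have pi2 := pihalf_ge1 R.
have [r /andP[sr rt]|r /andP[sr rt]] := muhat_Rolle st _ mst.
  by rewrite gt_eqF// cos_gt0_pihalf//; lra.
rewrite /tan => /eqP; rewrite gt_eqF// addr_gt0// mulr_gt0//; first lra.
by rewrite divr_gt0 ?sin_gt0_pihalf ?cos_gt0_pihalf//; lra.
Qed.

Lemma cos_neq0_itv (k : nat) s :
  k%:R * pi - pi / 2 < s < k%:R * pi + pi / 2 -> cos s != 0.
Proof.
move=> /andP[ks sk].
rewrite -[s](subrK (pi *+ k)) (alternatingn (@cosDpi R)) mulf_neq0//.
  by rewrite expf_neq0// oppr_eq0 oner_eq0.
by rewrite gt_eqF// cos_gt0_pihalf// -[pi *+ k]mulr_natl; lra.
Qed.

Lemma cos_mulr_pi_subr_pihalf (k : nat) : cos (k%:R * pi - pi / 2) = 0 :> R.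
Proof.
rewrite addrC mulr_natl (alternatingn (@cosDpi R)) cosN cos_pihalf.
by rewrite mulr0.
Qed.

Lemma finite_set_lt3 (A : set R) :
  (forall a b c, A a -> A b -> A c -> a < b -> b < c -> False) -> finite_set A.
Proof.
move=> A3; have [->|/set0P[a Aa]] := eqVneq A set0; first exact: finite_set0.
have [[b [Ab ba]]|nb] := pselect (exists b, A b /\ b != a); last first.
  apply: (@sub_finite_set _ _ [set a]); last exact: finite_set1.
  move=> b Ab /=; apply/eqP/negPn/negP => ba.
  by apply: nb; exists b.
apply: (@sub_finite_set _ _ [set a; b]); last exact: finite_set2.
move=> c Ac /=.
have [->|ca] := eqVneq c a; first by left.
have [->|cb] := eqVneq c b; first by right.
exfalso; move: ba ca cb; rewrite !neq_lt.
by move=> /orP[] h1 /orP[] h2 /orP[] h3; eauto using A3, lt_trans.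
Qed.

Lemma finite_muhat_level mu :
  finite_set [set s | [/\ 0 < s, cos s != 0 & muhat s = mu]].
Proof.
pose S k := [set s : R | [/\ 0 < s, k%:R * pi - pi / 2 < s < k%:R * pi + pi / 2
  & muhat s = mu]].
have pi0 := pi_gt0 R.
(* The branch of [s] has index [truncn (s / pi + 1 / 2)], and [muhat_ge] gives [s <= mu + 1 / 2] on
   the level set. *)
pose M := Num.truncn ((mu + 1 / 2) / pi + 1 / 2).
apply: (@sub_finite_set _ _ (\bigcup_(k in `I_M.+1) S k)).
  move=> s [s0 cs smu].
  have sp0 : 0 <= s / pi + 1 / 2 by rewrite addr_ge0// divr_ge0// ltW.
  exists (Num.truncn (s / pi + 1 / 2)).
    rewrite /= ltnS le_truncn// lerD2r ler_pM2r ?invr_gt0// -smu.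
    by have := muhat_ge cs s0; lra.
  have /andP[] := truncn_itv sp0; set k := Num.truncn _ => ks sk.
  have {}ks : k%:R * pi <= s + pi / 2.
    by move: ks; rewrite -(ler_pM2r pi0) mulrDl mulfVK ?gt_eqF//; lra.
  have {}sk : s + pi / 2 < k%:R * pi + pi.
    by move: sk; rewrite -(ltr_pM2r pi0) mulrDl mulfVK ?gt_eqF// -natr1; lra.
  split => //; apply/andP; split; last lra.
  rewrite lt_neqAle; apply/andP; split; last lra.
  by apply: contra_neq cs => <-; exact: cos_mulr_pi_subr_pihalf.
apply: bigcup_finite => [|k _]; first exact: finite_II.
(* Three solutions on one branch would yield, by Rolle, two zeros of the increasing function
   [1 + r * tan r]. *)
apply: finite_set_lt3 => a b c [a0 /andP[ka ak] am] [b0 /andP[kb bk] bm].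
move=> [c0 /andP[kc ck] cm] ab bc.
have cn r : a <= r <= c -> cos r != 0.
  move=> /andP[ar rc]; apply: (@cos_neq0_itv k); apply/andP; split; lra.
have [||r /andP[ar rb] r0] := @muhat_Rolle a b ab; [|by rewrite am|].
  by move=> r /andP[ar rb]; apply: cn; rewrite ar; lra.
have [||q /andP[bq qc] q0] := @muhat_Rolle b c bc; [|by rewrite bm|].
  by move=> q /andP[bq qc]; apply: cn; rewrite qc; lra.
have rq : r < q by lra.
have := @lt_1DidMtan r q _ rq; rewrite r0 q0 ltxx => /(_ _ _)/notF; apply.
  lra.
by move=> p /andP[rp pq]; apply: cn; apply/andP; split; lra.
Qed.

Lemma sin_eq0_gt0 s : 0 < s -> sin s = 0 -> exists k : nat, s = k%:R * pi.
Proof.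
move=> s0; have pi0 := pi_gt0 R.
have sp0 : 0 <= s / pi by rewrite divr_ge0// ltW.
have /andP[] := truncn_itv sp0; set k := Num.truncn _ => ks sk ss.
exists k; apply/eqP.
move: ks sk; rewrite ler_pdivlMr// ltr_pdivrMr// => ks sk.
rewrite eq_le ks andbT leNgt; apply/negP => {}ks.
have : 0 < sin (s - pi *+ k).
  by apply: sin_gt0_pi; rewrite -[pi *+ k]mulr_natl; move: sk; rewrite -natr1; lra.
move: ss; rewrite -[s in sin s = _](subrK (pi *+ k)).
rewrite (alternatingn (@sinDpi R)) => /eqP.
rewrite mulf_eq0 expf_eq0 oppr_eq0 oner_eq0 andbF/= => /eqP ->.
by rewrite ltxx.
Qed.

End muhat.

(** * The sub-Riemannian norm and the Lagrangian *)


Section dot_theory.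
Context {R : realType} {n : nat}.
Implicit Types (x y z : 'rV[R]_n) (a b : R).

Lemma dotC x y : dot x y = dot y x.
Proof. by apply: eq_bigr => j _; rewrite mulrC. Qed.

Lemma dotDl x y z : dot (x + y) z = dot x z + dot y z.
Proof. by rewrite -big_split; apply: eq_bigr => j _ /=; rewrite mxE mulrDl. Qed.

Lemma dotZl a x y : dot (a *: x) y = a * dot x y.
Proof. by rewrite mulr_sumr; apply: eq_bigr => j _; rewrite mxE mulrA. Qed.

Lemma dotDr x y z : dot x (y + z) = dot x y + dot x z.
Proof. by rewrite dotC dotDl !(dotC x). Qed.

Lemma dotZr a x y : dot x (a *: y) = a * dot x y.
Proof. by rewrite dotC dotZl dotC. Qed.

Lemma dot0l x : dot 0 x = 0.
Proof. by rewrite -(scale0r x) dotZl mul0r. Qed.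

Lemma dot0r x : dot x 0 = 0.
Proof. by rewrite dotC dot0l. Qed.

Lemma dotNl x y : dot (- x) y = - dot x y.
Proof. by rewrite -scaleN1r dotZl mulN1r. Qed.

Lemma dot_ge0 x : 0 <= dot x x.
Proof. by apply: sumr_ge0 => j _; rewrite -expr2 sqr_ge0. Qed.

Lemma dot_eq0 x : (dot x x == 0) = (x == 0).
Proof.
apply/eqP/eqP => [|->]; last by rewrite dot0l.
move/eqP; rewrite psumr_eq0 => [/allP x0|j _]; last by rewrite -expr2 sqr_ge0.
apply/rowP => j; rewrite mxE; apply/eqP.
by have := x0 j (mem_index_enum _); rewrite mulf_eq0 orbb.
Qed.

Lemma dot_gt0 x : (0 < dot x x) = (x != 0).
Proof. by rewrite lt_neqAle eq_sym dot_eq0 dot_ge0 andbT. Qed.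

Lemma sqr_enorm x : enorm x ^+ 2 = dot x x.
Proof. by rewrite sqr_sqrtr// dot_ge0. Qed.

Lemma enorm_ge0 x : 0 <= enorm x.
Proof. exact: sqrtr_ge0. Qed.

Lemma enorm_gt0 x : (0 < enorm x) = (x != 0).
Proof. by rewrite sqrtr_gt0 dot_gt0. Qed.

Lemma enormZ a x : enorm (a *: x) = `|a| * enorm x.
Proof. by rewrite /enorm dotZl dotZr mulrA -expr2 sqrtrM ?sqr_ge0// sqrtr_sqr. Qed.

Lemma dot_delta x j : dot x (delta_mx 0 j) = x 0 j.
Proof.
rewrite /dot (bigD1 j)//= !mxE !eqxx mulr1 big1 ?addr0// => i ij.
by rewrite !mxE (negPf ij) andbF mulr0.
Qed.

Lemma Cauchy_Schwarz_dot x y : dot x y ^+ 2 <= dot x x * dot y y.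
Proof.
have [->|] := eqVneq y 0; first by rewrite !dot0r expr0n mulr0.
rewrite -dot_gt0 => y0.
have := dot_ge0 (dot y y *: x + (- dot x y) *: y).
rewrite !(dotDl, dotDr, dotZl, dotZr) (dotC y x).
set p := dot x x; set q := dot y y in y0 *; set r := dot x y.
rewrite (_ : _ + _ = q * (p * q - r ^+ 2)); last by ring.
by rewrite pmulr_rge0// subr_ge0.
Qed.

End dot_theory.

Section hnorm_theory.
Context {R : realType} {n : nat}.
Implicit Types (p q v w : 'rV[R]_n * R) (x : 'rV[R]_n).

Lemma field_combE p alpha beta :
  field_comb p alpha beta = (\row_j alpha j, \sum_(j < n) beta j * p.1 0 j).
Proof.
rewrite /field_comb /Xfield /Ufield.
apply: (@eq_trans _ _ (\sum_(j < n) (alpha j *: delta_mx 0 j, beta j * p.1 0 j))).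
  by apply: eq_bigr => j _; congr pair => /=; rewrite scaler0 ?addr0 ?add0r.
rewrite [LHS]surjective_pairing; congr pair.
  rewrite (raddf_sum fst)/=; apply/rowP => j; rewrite summxE mxE (bigD1 j)//=.
  rewrite !mxE !eqxx mulr1 big1 ?addr0// => i ij.
  by rewrite !mxE eq_sym (negPf ij) andbF mulr0.
by rewrite (raddf_sum snd).
Qed.

(** Over {x = 0} every [Ufield] vanishes; elsewhere the fields span all directions, a vertical
    component being produced by a [beta] proportional to [p.1]. *)
Lemma horizontal_vectorP p v :
  horizontal_vector p v <-> (p.1 = 0 -> v.2 = 0).
Proof.
split=> [[al [be ->]] p0|pv].
  by rewrite field_combE p0/= big1// => j _; rewrite mxE mulr0.
exists (fun j => v.1 0 j), (fun j => v.2 / dot p.1 p.1 * p.1 0 j).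
rewrite field_combE [LHS]surjective_pairing; congr pair.
  by apply/rowP => j; rewrite mxE.
under eq_bigr do rewrite -mulrA.
rewrite -mulr_sumr -/(dot p.1 p.1).
have [p0|p0] := eqVneq p.1 0; first by rewrite pv// !mul0r.
by rewrite divfK// dot_eq0.
Qed.

(** The multiple of [p.1] is the cheapest [beta], by Cauchy-Schwarz. The formula also covers
    [p.1 = 0]: then the inverse is [0] by convention and [beta = 0] is optimal. *)
Lemma hnorm_sqE p v : horizontal_vector p v ->
  hnorm_sq p v = (dot v.1 v.1 + v.2 ^+ 2 / dot p.1 p.1)%:E.
Proof.
move=> pv; apply/eqP; rewrite eq_le; apply/andP; split.
  apply: ereal_inf_lbound.
  exists (fun j => v.1 0 j), (fun j => v.2 / dot p.1 p.1 * p.1 0 j); split.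
    rewrite field_combE [LHS]surjective_pairing; congr pair.
      by apply/rowP => j; rewrite mxE.
    under eq_bigr do rewrite -mulrA.
    rewrite -mulr_sumr -/(dot p.1 p.1).
    have [p0|p0] := eqVneq p.1 0.
      by have/horizontal_vectorP -> := pv; rewrite ?mul0r.
    by rewrite divfK// dot_eq0.
  congr EFin; rewrite big_split/=; congr +%R.
  under eq_bigr do rewrite exprMn expr2 -mulrA.
  under eq_bigr do rewrite [_ ^+ 2](expr2 (p.1 _ _)).
  rewrite -!mulr_sumr -/(dot p.1 p.1).
  have [->|p0] := eqVneq (dot p.1 p.1) 0; first by rewrite invr0 !mulr0.
  by field.
apply: le_ereal_inf_tmp => _ [al [be [-> ->]]].
rewrite lee_fin field_combE/= big_split/= lerD//.
  by rewrite /dot (eq_bigr (fun i => al i ^+ 2))// => i _; rewrite !mxE -expr2.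
have [->|p0] := eqVneq p.1 0.
  by rewrite dot0l invr0 mulr0 sumr_ge0// => j _; rewrite sqr_ge0.
rewrite ler_pdivrMr ?dot_gt0//.
have := Cauchy_Schwarz_dot (\row_j be j) p.1.
rewrite /dot; under [X in X ^+ 2]eq_bigr do rewrite mxE.
move=> /le_trans; apply; rewrite ler_wpM2r//; first exact: dot_ge0.
by rewrite (eq_bigr (fun i => be i ^+ 2))// => i _; rewrite !mxE -expr2.
Qed.

Definition speed p v : R := Num.sqrt (dot v.1 v.1 + v.2 ^+ 2 / dot p.1 p.1).

Lemma hnormE p v : horizontal_vector p v -> hnorm p v = (speed p v)%:E.
Proof. by move=> pv; rewrite /hnorm hnorm_sqE. Qed.

Lemma hnorm_ge0 p v : (0 <= hnorm p v)%E.
Proof. exact: sqrte_ge0. Qed.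

Lemma lagrangianE p v : p.1 != 0 ->
  lagrangian p v = dot v.1 v.1 + v.2 ^+ 2 / dot p.1 p.1.
Proof.
move=> p0; rewrite /lagrangian hnorm_sqE//.
by apply/horizontal_vectorP => p0'; rewrite p0' eqxx in p0.
Qed.

(** Turns a directional derivative into one in a real variable, to which [der] applies. *)
Lemma derive_line (V W : normedModType R) (f : V -> W) (a v : V) :
  'D_v f a = 'D_1 (fun h : R => f (h *: v + a)) 0.
Proof.
rewrite /derive; set g1 := fun h => h^-1 *: _; set g2 := fun h => h^-1 *: _.
suff -> : g1 = g2 by [].
by apply/funext => h; rewrite /g1 /g2/= addr0 scale0r add0r [_%:A]mulr1.
Qed.

Lemma derive_lagrangian_velocity p v w : p.1 != 0 ->
  'D_w (fun v => lagrangian p v) v =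
    2 * dot v.1 w.1 + 2 * (v.2 / dot p.1 p.1) * w.2.
Proof.
move=> p0; rewrite derive_line.
rewrite (_ : (fun h => _) = fun h : R => h * h * dot w.1 w.1 + h * (2 * dot v.1 w.1)
   + dot v.1 v.1 + (h * w.2 + v.2) ^+ 2 * (dot p.1 p.1)^-1); last first.
  apply/funext => h; rewrite lagrangianE//= -[h *: w.2]/(h * w.2).
  by rewrite !(dotDl, dotDr, dotZl, dotZr) (dotC w.1 v.1); ring.
apply: derive_val; der; ring.
Qed.

Lemma derive_lagrangian_position p v w : p.1 != 0 ->
  'D_w (fun q => lagrangian q v) p =
    - 2 * (v.2 / dot p.1 p.1) ^+ 2 * dot p.1 w.1.
Proof.
move=> p0; rewrite derive_line.
pose Q (h : R) := h * h * dot w.1 w.1 + h * (2 * dot p.1 w.1) + dot p.1 p.1.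
have QE h : Q h = dot (h *: w.1 + p.1) (h *: w.1 + p.1).
  by rewrite !(dotDl, dotDr, dotZl, dotZr) (dotC w.1 p.1) /Q; ring.
have dQ : is_derive (0 : R) 1 Q (2 * dot p.1 w.1) by rewrite /Q; der; ring.
have Q0 : Q 0 != 0 by rewrite QE scale0r add0r dot_eq0.
have Q0E : Q 0 = dot p.1 p.1 by rewrite QE scale0r add0r.
(* The closed formula for the Lagrangian is only available off {x = 0}, hence only for small [h]. *)
rewrite (@near_eq_derive _ _ _ _ (fun h => dot v.1 v.1 + v.2 ^+ 2 * (Q h)^-1)).
  apply: derive_val; der => //; rewrite Q0E; field.
  by rewrite -Q0E.
have : \forall h \near 0, Q h != 0.
  exact: (cvgr_neq0 _ (is_derive_continuous dQ) Q0).
apply: filterS => h Qh; rewrite lagrangianE ?QE//=.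
by rewrite -dot_eq0 -QE.
Qed.

End hnorm_theory.

Section derive_components.
Context {R : realType} {n : nat}.

Lemma is_deriveP (V W : normedModType R) (f : V -> W) (x v : V) (l : W) :
  is_derive x v f l <-> (h^-1 *: (f (h *: v + x) - f x)) @[h --> 0^'] --> l.
Proof.
split=> [[/cvg_ex[l' fl'] <-]|fl].
  by rewrite /derive (cvg_lim _ fl').
by apply: DeriveDef; [apply/cvg_ex; exists l|exact: cvg_lim fl].
Qed.

Lemma is_derive_pairP (g : R -> 'rV[R]_n * R) (t : R) (l : 'rV[R]_n * R) :
  is_derive t 1 g l <->
  (forall j, is_derive t 1 (fun s => (g s).1 0 j) (l.1 0 j)) /\
  is_derive t 1 (fun s => (g s).2) l.2.
Proof.
have rowP' (f : R -> 'rV[R]_n) (a : 'rV[R]_n) : is_derive t 1 f a <->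
    forall j, is_derive t 1 (fun s => f s 0 j) (a 0 j).
  split=> [[df <-] j|fa].
    apply: DeriveDef; first exact: ((derivable_mxP f t 1).1 df).
    by rewrite derive_mx// mxE.
  have df : derivable f t 1.
    by apply/derivable_mxP => i j; rewrite ord1; exact: ex_derive.
  apply: DeriveDef => //; rewrite derive_mx//.
  by apply/rowP => j; rewrite mxE; exact: derive_val.
rewrite -(rowP' (fun s => (g s).1) l.1); split.
  move=> /is_deriveP gl; split; apply/is_deriveP.
    exact: (cvg_comp (fun h : R => h^-1 *: (g (h *: 1 + t) - g t)) fst gl cvg_fst).
  exact: (cvg_comp (fun h : R => h^-1 *: (g (h *: 1 + t) - g t)) snd gl cvg_snd).
case=> /is_deriveP g1 /is_deriveP g2; apply/is_deriveP.
rewrite [l]surjective_pairing; exact: cvg_pair g1 g2.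
Qed.

End derive_components.

Section lipschitz_curves.
Context {R : realType} {n : nat}.
Implicit Types (g : R -> 'rV[R]_n * R).

Lemma norm_pair_le (q : 'rV[R]_n * R) K : 0 <= K ->
  (forall j, `|q.1 0 j| <= K) -> `|q.2| <= K -> `|q| <= K.
Proof.
move=> K0 q1 q2; rewrite [`|q|]prod_normE/= ge_max q2 andbT.
rewrite [leLHS]/Num.Def.normr/= mx_normrE.
by apply: bigmax_le => // -[i j] _ /=; rewrite ord1.
Qed.

Lemma norm_fst_le (q : 'rV[R]_n * R) j : `|q.1 0 j| <= `|q|.
Proof.
rewrite [`|q|]prod_normE/= le_max; apply/orP; left.
rewrite [leRHS]/Num.Def.normr/= mx_normrE.
exact: (le_bigmax _ (fun ij : 'I_1 * 'I_n => `|q.1 ij.1 ij.2|) (0, j)).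
Qed.

Lemma norm_snd_le (q : 'rV[R]_n * R) : `|q.2| <= `|q|.
Proof. by rewrite [`|q|]prod_normE/= le_max lexx orbT. Qed.

Lemma lipschitz_abs_continuous01 g K :
  (forall s t, 0 <= s -> s <= t -> t <= 1 -> `|g t - g s| <= K * (t - s)) ->
  abs_continuous01 g.
Proof.
move=> gK e e0.
have K0 : 0 <= K.
  by have := gK 0 1 (lexx _) ler01 (lexx _); rewrite subr0 mulr1; exact: le_trans.
have K1 : 0 < K + 1 by rewrite ltr_wpDl.
exists (e / (K + 1)); first by rewrite divr_gt0.
move=> k a b ab _; rewrite ltr_pdivlMr// => abe.
apply: le_lt_trans abe.
apply: (@le_trans _ _ (\sum_(i < k) K * (b i - a i))).
  by apply: ler_sum => i _; have [? ? ?] := ab i; exact: gK.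
rewrite -mulr_sumr mulrC ler_wpM2l ?lerDl//.
by apply: sumr_ge0 => i _; have [_ ? _] := ab i; rewrite subr_ge0.
Qed.

Lemma is_derive_lipschitz (f df : R -> R) (K s t : R) :
  (forall r : R, is_derive r 1 f (df r)) -> (forall r, `|df r| <= K) ->
  s <= t -> `|f t - f s| <= K * (t - s).
Proof.
move=> fdf dfK; rewrite le_eqVlt => /predU1P[->|st].
  by rewrite !subrr normr0 mulr0.
have [r _ ->] := @MVT_is_derive _ f df s t st (fun r _ => fdf r).
by rewrite normrM (gtr0_norm (x := t - s)) ?subr_gt0// ler_wpM2r// subr_ge0 ltW.
Qed.

End lipschitz_curves.

Section clength_theory.
Context {R : realType} {n : nat}.
Implicit Types (g : R -> 'rV[R]_n * R).

(** Only interior times are used: a curve that coincides with a geodesic on [0, 1] is arbitrary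
    outside, so its derivative is under control only on the open interval. *)
Lemma clength_cst g K :
  (forall t, 0 < t < 1 -> hnorm (g t) ('D_1 g t) = K%:E) ->
  clength g = K%:E.
Proof.
move=> gK; rewrite /clength; set f := fun t => hnorm (g t) ('D_1 g t).
rewrite integral_itv_bndoo; last first.
  apply: eq_measurable_fun (measurable_cst K%:E) => t.
  by rewrite inE/= in_itv/= => /gK.
rewrite (eq_integral (cst K%:E)); last first.
  by move=> t; rewrite inE/= in_itv/= => /gK.
by rewrite integral_cst//= lebesgue_measure_itv/= lte_fin ltr01 -EFinB subr0 mule1.
Qed.

End clength_theory.

(** * The explicit geodesics: Euler-Lagrange equations and length *)

Section geod_theory.
Context {R : realType} {n : nat}.
Context (x : 'rV[R]_n) (b : R) (c : 'rV[R]_n).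
Implicit Types (g : R -> 'rV[R]_n * R) (s t : R).

(** The solution of [q'' = - b^2 q] with [q 0 = 0] and [q' 0 = 1]; it merges the two cases of
    [geod]. *)
Definition sinc (t : R) : R := if b == 0 then t else sin (b * t) / b.

Definition geod_velocity (t : R) : 'rV[R]_n :=
  cos (b * t) *: c - (b * sin (b * t)) *: x.

Lemma sincE t : b * sinc t = sin (b * t).
Proof.
rewrite /sinc; case: eqVneq => [->|b0]; first by rewrite !mul0r sin0.
by field.
Qed.

Lemma is_derive_sinc t : is_derive t 1 sinc (cos (b * t)).
Proof.
rewrite /sinc; case: eqVneq => [->|b0]; first by rewrite mul0r cos0; der.
der; field; exact: b0.
Qed.

Lemma geod_fst t : (geod x b c t).1 = sinc t *: c + cos (b * t) *: x.
Proof.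
rewrite /geod /sinc; case: eqVneq => [->|b0]//=.
by rewrite mul0r cos0 scale1r.
Qed.

Lemma is_derive_geod t : is_derive t 1 (geod x b c)
  (geod_velocity t, b * dot (geod x b c t).1 (geod x b c t).1).
Proof.
apply/is_derive_pairP; split => [j|] /=.
  under eq_fun do rewrite geod_fst !mxE.
  have := is_derive_sinc t => d1.
  by der; rewrite /geod_velocity !mxE; ring.
rewrite geod_fst !(dotDl, dotDr, dotZl, dotZr) (dotC x c) -!sqr_enorm.
rewrite /geod /sinc; case: eqVneq => [->|b0] /=.
  by rewrite mul0r; exact: is_derive_cst.
der.
have -> : 2 * b * t = (b * t) *+ 2 by rewrite -mulrA mulr_natl.
rewrite cos_mulr2n (dotC x c).
by field: (cos2sin2 (b * t)).
Qed.

Lemma is_derive_geod_velocity t j :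
  is_derive t 1 (fun s => geod_velocity s 0 j)
    (- b ^+ 2 * (geod x b c t).1 0 j).
Proof.
rewrite geod_fst !mxE.
under eq_fun do rewrite /geod_velocity !mxE.
by der; rewrite -sincE; ring.
Qed.

(** The left-hand side is the squared speed, the vertical velocity being [b |g1|^2]. Its
    conservation yields the length and the Lipschitz bounds. *)
Lemma geod_energy t : dot (geod_velocity t) (geod_velocity t) +
  b ^+ 2 * dot (geod x b c t).1 (geod x b c t).1 = dot c c + b ^+ 2 * dot x x.
Proof.
rewrite geod_fst /geod_velocity !(dotDl, dotDr, dotNl, dotZl, dotZr).
rewrite -scaleNr !(dotZl, dotZr) (dotC x c) -sincE.
have := cos2Dsin2 (b * t); rewrite -sincE => E.
move: (sinc t) (cos (b * t)) E (dot c x) (dot c c) (dot x x) => S C E p q r.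
rewrite -[RHS]mul1r -E; ring.
Qed.

Lemma horizontal_geod t : horizontal_vector (geod x b c t) ('D_1 (geod x b c) t).
Proof.
have -> := derive_val (is_derive := is_derive_geod t).
by apply/horizontal_vectorP => -> /=; rewrite dot0l mulr0.
Qed.

Lemma abs_continuous01_geod : abs_continuous01 (geod x b c).
Proof.
set E := dot c c + b ^+ 2 * dot x x.
have E0 : 0 <= E.
  by rewrite addr_ge0 ?dot_ge0// mulr_ge0 ?sqr_ge0 ?dot_ge0.
have v1 t j : `|geod_velocity t 0 j| <= E + 1.
  have : `|geod_velocity t 0 j| ^+ 2 <= E.
    rewrite /E -(geod_energy t) real_normK ?num_real//.
    rewrite ler_wpDr//; first by rewrite mulr_ge0 ?sqr_ge0 ?dot_ge0.
    rewrite /dot (bigD1 j)//= -expr2 lerDl sumr_ge0// => i _.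
    by rewrite -expr2 sqr_ge0.
  by have := normr_ge0 (geod_velocity t 0 j); nra.
have v2 t : `|b * dot (geod x b c t).1 (geod x b c t).1| <= E / `|b|.
  have [->|b0] := eqVneq b 0; first by rewrite mul0r normr0 invr0 mulr0.
  rewrite ler_pdivlMr ?normr_gt0// -normrM mulrAC -expr2 ger0_norm.
    by rewrite /E -(geod_energy t) lerDr dot_ge0.
  by rewrite mulr_ge0 ?sqr_ge0 ?dot_ge0.
have b0 : 0 <= E / `|b| by rewrite divr_ge0.
apply: (@lipschitz_abs_continuous01 _ _ _ (E + 1 + E / `|b|)) => s t _ st _.
have ts : 0 <= t - s by rewrite subr_ge0.
apply: norm_pair_le => [|j|].
- by rewrite mulr_ge0// addr_ge0// addr_ge0.
- rewrite /= !mxE.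
  apply: (@is_derive_lipschitz _ (fun t => (geod x b c t).1 0 j)
    (fun t => geod_velocity t 0 j)) => // r.
    by have /is_derive_pairP[+ _] := is_derive_geod r; apply.
  by rewrite (le_trans (v1 r j))// lerDl.
- apply: (@is_derive_lipschitz _ (fun t => (geod x b c t).2)
    (fun t => b * dot (geod x b c t).1 (geod x b c t).1)) => // r.
    by have /is_derive_pairP[_ +] := is_derive_geod r; apply.
  by rewrite (le_trans (v2 r))// lerDr addr_ge0.
Qed.

Lemma is_geodesic_geod : is_geodesic (geod x b c).
Proof.
split.
  split; first exact: abs_continuous01_geod.
  apply: aeW => t _; split; last exact: horizontal_geod.
  exact: (ex_derive (is_derive := is_derive_geod t)).
(* Off {x = 0} the momentum is twice the pair of the horizontal velocity and [g2' / |g1|^2 = b];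
   this expression extends smoothly through the crossings. *)
exists (fun t => (2 *: geod_velocity t, 2 * b)) => t _.
have dP : is_derive t 1 (fun t => (2 *: geod_velocity t, 2 * b))
    ((- 2 * b ^+ 2) *: (geod x b c t).1, 0).
  apply/is_derive_pairP; split => [j|] /=; last exact: is_derive_cst.
  under eq_fun do rewrite mxE.
  by have := is_derive_geod_velocity t j => d; der; rewrite !mxE; ring.
have dg := is_derive_geod t.
split; [exact: (ex_derive (is_derive := dg))|exact: (ex_derive (is_derive := dP))|].
move=> g0 w; rewrite (derive_val (is_derive := dg)) (derive_val (is_derive := dP)).
rewrite derive_lagrangian_velocity// derive_lagrangian_position// /pairing/=.
by rewrite mulfK ?dot_eq0// !dotZl mul0r addr0.
Qed.

Lemma geod0 : geod x b c 0 = (x, 0).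
Proof.
rewrite /geod; case: eqVneq => [_|_]; first by rewrite scale0r add0r.
rewrite !mulr0 sin0 cos0 mul0r scale0r scale1r add0r; congr pair.
by rewrite expr0n/= !mul0r subrr addr0 !mulr0 !addr0.
Qed.

Lemma clength_geod g : {in `[0, 1], g =1 geod x b c} ->
  clength g = (Num.sqrt (enorm c ^+ 2 + b ^+ 2 * enorm x ^+ 2))%:E.
Proof.
move=> gE; apply: clength_cst => t /andP[t0 t1].
have -> : 'D_1 g t = 'D_1 (geod x b c) t.
  apply: near_eq_derive; near=> s; apply: gE; rewrite in_itv/=.
  by apply/andP; split; apply: ltW; near: s; [exact: lt_nbhsr|exact: lt_nbhsl].
rewrite gE; last by rewrite in_itv/= !ltW.
rewrite hnormE; last exact: horizontal_geod.
rewrite /speed (derive_val (is_derive := is_derive_geod t))/=.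
rewrite !sqr_enorm -(geod_energy t); congr (Num.sqrt (_ + _))%:E.
have [->|A0] := eqVneq (dot (geod x b c t).1 (geod x b c t).1) 0.
  by rewrite invr0 !mulr0.
by field.
Unshelve. all: by end_near. Qed.

End geod_theory.

(** * Uniqueness of geodesics *)


Section one_variable.
Context {R : realType}.
Implicit Types (f : R -> R) (a b s t : R).

(** Carries the identity with an explicit geodesic across the zeros of the first component, which
    are not located in advance. *)
Lemma real_induction (Q : R -> Prop) a b :
  (exists2 d, 0 < d & forall t, a < t < a + d -> Q t) ->
  (forall T, a < T < b -> (forall t, a < t < T -> Q t) -> Q T) ->
  (forall T, a < T < b -> (forall t, a < t <= T -> Q t) ->
    exists2 d, 0 < d & forall t, T < t < T + d -> Q t) ->
  forall t, a < t < b -> Q t.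
Proof.
move=> [d d0 Qa] Qcl Qop t /andP[at_ tb].
apply: contrapT => nQt.
pose S := [set s | a < s <= t /\ forall r, a < r < s -> Q r].
have St : ubound S t by move=> s [/andP[_ ->]].
have Sd : S (Num.min t (a + d)).
  split; first by rewrite lt_min at_ ltrDl d0/= ge_min lexx.
  by move=> r; rewrite lt_min => /and3P[ar _ rd]; apply: Qa; rewrite ar.
have hS : has_sup S by split; [exists (Num.min t (a + d))|exists t].
pose T := sup S.
have aT : a < T.
  apply: lt_le_trans (ub_le_sup _ Sd); last by exists t.
  by rewrite lt_min at_ ltrDl.
have Tt : T <= t by apply: ge_sup => //; exists (Num.min t (a + d)).
have QT r : a < r < T -> Q r.
  move=> /andP[ar rT]; have rT0 : 0 < T - r by rewrite subr_gt0.
  have [s [_ Qs] rs] := sup_adherent rT0 hS.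
  by apply: Qs; rewrite ar/=; move: rs; rewrite opprB addrC subrK.
have QTT : Q T by apply: Qcl QT; rewrite aT (le_lt_trans Tt).
have {}Tt : T < t by rewrite lt_neqAle Tt andbT; apply/eqP => E; rewrite -E in nQt.
have [|r /andP[ar]|e e0 Qe] := Qop T; first by rewrite aT (lt_trans Tt).
  by rewrite le_eqVlt => /predU1P[->//|rT]; apply: QT; rewrite ar.
have : S (Num.min t (T + e)).
  split; first by rewrite lt_min at_ ge_min lexx/= andbT (lt_trans aT)// ltrDl.
  move=> r; rewrite lt_min => /and3P[ar _ re].
  have [rT|rT|->//] := ltgtP r T; first by apply: QT; rewrite ar.
  by apply: Qe; rewrite rT.
move=> /(ub_le_sup _) => /(_ _)/wrap[]; first by exists t.
by rewrite leNgt -/T lt_min Tt ltrDl e0.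
Qed.

Lemma derivable_continuous f t : derivable f t 1 -> {for t, continuous f}.
Proof. by move=> df; apply: differentiable_continuous; apply/derivable1_diffP. Qed.

Lemma is_derive0_cst f a b : a <= b ->
  (forall r, a <= r <= b -> derivable f r 1) ->
  (forall r, a < r < b -> is_derive r 1 f 0) -> f b = f a.
Proof.
rewrite le_eqVlt => /predU1P[->//|ab] df f0.
have cf : {within `[a, b], continuous f}.
  by apply: derivable_within_continuous => r; rewrite in_itv/=; exact: df.
have f0' r : r \in `]a, b[ -> is_derive r 1 f 0 by rewrite in_itv/=; exact: f0.
have [r _ /eqP] := @MVT R f (fun=> 0) a b ab f0' cf.
by rewrite mul0r subr_eq0 => /eqP.
Qed.

(** At a crossing time only the past is known to agree with the model; as both functions are
    differentiable, the left difference quotients already determine the derivatives. *)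
Lemma is_derive_left_eq f g t df dg a : a < t -> is_derive t 1 f df ->
  is_derive t 1 g dg -> (forall s, a < s <= t -> f s = g s) -> df = dg.
Proof.
move=> at_ /is_deriveP fl /is_deriveP gl fg.
have fl' : h^-1 *: (f (h *: 1 + t) - f t) @[h --> 0^'-] --> df.
  exact: cvg_dnbhs_at_left fl.
have gl' : h^-1 *: (g (h *: 1 + t) - g t) @[h --> 0^'-] --> dg.
  exact: cvg_dnbhs_at_left gl.
apply: (cvg_unique _ fl'); first exact: Rhausdorff.
apply: cvg_trans gl'; apply: near_eq_cvg; near=> h.
rewrite !fg// ?at_ ?lexx// [h *: 1]mulr1.
have h0 : h < 0 by near: h; exact: nbhs_left_lt.
have ha : a - t < h by near: h; apply: nbhs_left_gt; rewrite subr_lt0.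
by apply/andP; split; lra.
Unshelve. all: by end_near. Qed.

Lemma is_derive_neq0_right f t d : is_derive t 1 f d -> d != 0 -> f t = 0 ->
  exists2 e, 0 < e & forall s, t < s < t + e -> f s != 0.
Proof.
move=> /is_deriveP fl d0 ft.
have /nbhs_ballP[e /= e0 He] : nbhs (0 : R)
    (fun h => h != 0 -> h^-1 *: (f (h *: 1 + t) - f t) != 0).
  exact: (cvgr_neq0 _ fl d0).
exists e => // s /andP[ts ste].
have := He (s - t); rewrite /ball/= sub0r normrN gtr0_norm ?subr_gt0// ltrBlDl.
rewrite gt_eqF ?subr_gt0// => /(_ ste isT).
by rewrite ft subr0 [(s - t) *: 1]mulr1 subrK scaler_eq0 negb_or => /andP[].
Qed.

Lemma neq0_right f t : {for t, continuous f} -> f t != 0 ->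
  exists2 e, 0 < e & forall s, t < s < t + e -> f s != 0.
Proof.
move=> ft ft0; have /nbhs_ballP[e /= e0 He] : nbhs t (fun s => f s != 0).
  exact: (cvgr_neq0 _ ft ft0).
exists e => // s /andP[ts ste]; apply: He.
by rewrite /ball/= ltr0_norm ?subr_lt0// opprB ltrBlDl.
Qed.

End one_variable.

Section abs_continuous.
Context {R : realType} {n : nat}.
Implicit Types (g : R -> 'rV[R]_n * R) (s t : R).

Lemma abs_continuous01_le g e : abs_continuous01 g -> 0 < e ->
  exists2 d, 0 < d & forall s t, 0 <= s -> s <= t -> t <= 1 -> t - s < d ->
    `|g t - g s| < e.
Proof.
move=> gac e0; have [d d0 Hd] := gac e e0; exists d => // s t s0 st t1 std.
have := Hd 1%N (fun=> s) (fun=> t).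
rewrite !big_ord1; apply => //.
by move=> i j _ _ _; rewrite (ord1 i) (ord1 j).
Qed.

End abs_continuous.

Section rotation.
Context {R : realType} (b : R).
Implicit Types (q p : R -> R) (t : R).

(* The solution of [q' = p / 2], [p' = - 2 b^2 q] with initial values
   [q 0 = q0], [p 0 = 2 q1] is [q = sinc b * q1 + cos (b _) * q0]; [rot0] and
   [rot1] recover [q0] and [q1]. *)
Definition rot0 q p t := cos (b * t) * q t - sinc b t * (p t / 2).

Definition rot1 q p t := cos (b * t) * (p t / 2) + b * sin (b * t) * q t.

Lemma rotK q p t : q t = sinc b t * rot1 q p t + cos (b * t) * rot0 q p t.
Proof.
rewrite /rot0 /rot1 -[LHS]mul1r -(cos2Dsin2 (b * t)) -sincE; ring.
Qed.

Lemma rotK' q p t :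
  p t / 2 = cos (b * t) * rot1 q p t - b * sin (b * t) * rot0 q p t.
Proof.
rewrite /rot0 /rot1 -[LHS]mul1r -(cos2Dsin2 (b * t)) -sincE; ring.
Qed.

Lemma is_derive_rot0 q p t dq dp : is_derive t 1 q dq -> is_derive t 1 p dp ->
  is_derive t 1 (rot0 q p) (cos (b * t) * dq - b * sin (b * t) * q t
    - cos (b * t) * (p t / 2) - sinc b t * (dp / 2)).
Proof. by move=> d1 d2; have d3 := is_derive_sinc b t; rewrite /rot0; der; field. Qed.

Lemma is_derive_rot1 q p t dq dp : is_derive t 1 q dq -> is_derive t 1 p dp ->
  is_derive t 1 (rot1 q p) (cos (b * t) * (dp / 2) - b * sin (b * t) * (p t / 2)
   + b * sin (b * t) * dq + b ^+ 2 * cos (b * t) * q t).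
Proof. by move=> d1 d2; rewrite /rot1; der; field. Qed.

Lemma is_derive_rot_eq0 q p t : is_derive t 1 q (p t / 2) ->
  is_derive t 1 p (- (2 * b ^+ 2) * q t) ->
  is_derive t 1 (rot0 q p) 0 /\ is_derive t 1 (rot1 q p) 0.
Proof.
move=> d1 d2; split.
  by apply: is_derive_eq (is_derive_rot0 d1 d2) _; rewrite -sincE; field.
by apply: is_derive_eq (is_derive_rot1 d1 d2) _; field.
Qed.

End rotation.

(** * Solutions of the Euler-Lagrange equations are explicit geodesics *)

Section geodesic_uniqueness.
Context {R : realType} {n : nat}.
Context (g : R -> 'rV[R]_n * R) (x : 'rV[R]_n).
Context (x0 : x != 0) (g0 : g 0 = (x, 0)) (gac : abs_continuous01 g).
Context (P : R -> 'rV[R]_n * R).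
Context (gP : forall t : R, 0 < t < 1 ->
  [/\ derivable g t 1, derivable P t 1 &
    (g t).1 != 0 -> forall w : 'rV[R]_n * R,
      pairing (P t) w = 'D_w (fun v => lagrangian (g t) v) ('D_1 g t) /\
      pairing ('D_1 P t) w = 'D_w (fun q => lagrangian q ('D_1 g t)) (g t)]).

Let g1 j (t : R) : R := (g t).1 0 j.
Let g2 (t : R) : R := (g t).2.
Let p1 j (t : R) : R := (P t).1 0 j.
Let p2 (t : R) : R := (P t).2.

Let ex_g1 j (t : R) : 0 < t < 1 -> derivable (g1 j) t 1.
Proof.
move=> /gP[/derivableP/is_derive_pairP[dg _] _ _].
by have := dg j => d; exact: ex_derive.
Qed.

Let ex_g2 (t : R) : 0 < t < 1 -> derivable g2 t 1.
Proof. by move=> /gP[/derivableP/is_derive_pairP[_ dg] _ _]; exact: ex_derive. Qed.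

Let ex_p1 j (t : R) : 0 < t < 1 -> derivable (p1 j) t 1.
Proof.
move=> /gP[_ /derivableP/is_derive_pairP[dg _] _].
by have := dg j => d; exact: ex_derive.
Qed.

Let ex_p2 (t : R) : 0 < t < 1 -> derivable p2 t 1.
Proof. by move=> /gP[_ /derivableP/is_derive_pairP[_ dg] _]; exact: ex_derive. Qed.

(** Obtained by testing the Euler-Lagrange equations on the coordinate directions; the vertical
    momentum is constant because the Lagrangian does not depend on the vertical coordinate. *)
Let Hamilton (t : R) : 0 < t < 1 -> (g t).1 != 0 ->
  [/\ forall j, is_derive t 1 (g1 j) (p1 j t / 2),
      forall j, is_derive t 1 (p1 j) (- (p2 t ^+ 2 / 2) * g1 j t),
      is_derive t 1 g2 (p2 t / 2 * dot (g t).1 (g t).1) &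
      is_derive t 1 p2 0].
Proof.
move=> t01 gt0; have [dg dP EL] := gP t01.
have /is_derive_pairP[dg1 dg2] := derivableP dg.
have /is_derive_pairP[dP1 dP2] := derivableP dP.
have d0 : dot (g t).1 (g t).1 != 0 by rewrite dot_eq0.
have p2E : p2 t = 2 * ('D_1 g t).2 / dot (g t).1 (g t).1.
  have [+ _] := EL gt0 (0, 1); rewrite derive_lagrangian_velocity// /pairing/=.
  by rewrite !dot0r mulr0 !add0r !mulr1 mulrA.
split=> [j|j||].
- apply: is_derive_eq (dg1 j) _; rewrite /p1.
  have [+ _] := EL gt0 (delta_mx 0 j, 0); rewrite derive_lagrangian_velocity//.
  by rewrite /pairing/= !dot_delta !mulr0 !addr0 => ->; field.
- apply: is_derive_eq (dP1 j) _; rewrite p2E.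
  have [_] := EL gt0 (delta_mx 0 j, 0); rewrite derive_lagrangian_position//.
  rewrite /pairing/= !dot_delta !mulr0 !addr0 => ->; rewrite /g1.
  move: (dot _ _) d0 ('D_1 g t).2 ((g t).1 0 j) => r r0 q w.
  by field.
- by apply: is_derive_eq dg2 _; rewrite p2E; field.
- apply: is_derive_eq dP2 _.
  have [_] := EL gt0 (0, 1); rewrite derive_lagrangian_position//.
  by rewrite /pairing/= !dot0r mulr0 add0r mulr1.
Qed.


Let g_lim (e : R) : 0 < e ->
  exists2 d, 0 < d & forall t, 0 <= t -> t < d -> t <= 1 -> `|g t - (x, 0)| < e.
Proof.
move=> e0; have [d d0 Hd] := abs_continuous01_le gac e0.
by exists d => // t t0 td t1; rewrite -g0; apply: Hd => //; rewrite subr0.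
Qed.

Section constant_momentum.
Context (b : R).

Let X j := rot0 b (g1 j) (p1 j).
Let Y j := rot1 b (g1 j) (p1 j).
Let Z (c : 'rV[R]_n) (t : R) : R := g2 t - (geod x b c t).2.

Let ex_X j (t : R) : 0 < t < 1 -> derivable (X j) t 1.
Proof.
move=> t01; have d1 := ex_g1 (j := j) t01; have d2 := ex_p1 (j := j) t01.
by have d := is_derive_rot0 b (derivableP d1) (derivableP d2); exact: ex_derive.
Qed.

Let ex_Y j (t : R) : 0 < t < 1 -> derivable (Y j) t 1.
Proof.
move=> t01; have d1 := ex_g1 (j := j) t01; have d2 := ex_p1 (j := j) t01.
by have d := is_derive_rot1 b (derivableP d1) (derivableP d2); exact: ex_derive.
Qed.

Let ex_Z (c : 'rV[R]_n) (t : R) : 0 < t < 1 -> derivable (Z c) t 1.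
Proof.
move=> t01; have /is_derive_pairP[_ d2] := is_derive_geod x b c t.
by apply: derivableB; [exact: ex_g2|exact: (ex_derive (is_derive := d2))].
Qed.

(** Agreement with the model in position and momentum, expressed through quantities that are
    constant along solutions and remain differentiable at the crossings. *)
Let good (c : 'rV[R]_n) (t : R) := [/\ p2 t = 2 * b, forall j, X j t = x 0 j,
  forall j, Y j t = c 0 j & Z c t = 0].

Let good_geod (c : 'rV[R]_n) (t : R) : good c t -> g t = geod x b c t.
Proof.
move=> [_ Xt Yt /eqP]; rewrite /Z subr_eq0 => /eqP Zt.
rewrite [g t]surjective_pairing [RHS]surjective_pairing; congr pair => //.
apply/rowP => j; rewrite geod_fst !mxE -Xt -Yt.
exact: (rotK b (g1 j) (p1 j) t).
Qed.

(** The endpoints may be crossing times: the quantities are differentiable, hence continuous, there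
    as well. *)
Let cst_interval (s t : R) : 0 < s -> s <= t -> t < 1 ->
  (forall r, s < r < t -> (g r).1 != 0) -> p2 s = 2 * b ->
  [/\ p2 t = 2 * b, forall j, X j t = X j s & forall j, Y j t = Y j s].
Proof.
move=> s0 st t1 gn0 p2s.
have in01 r : s <= r <= t -> 0 < r < 1.
  by move=> /andP[sr rt]; rewrite (lt_le_trans s0)//= (le_lt_trans rt).
have in01' r : s < r < t -> 0 < r < 1.
  by move=> /andP[sr rt]; apply: in01; rewrite !ltW.
have p2E r : s <= r <= t -> p2 r = 2 * b.
  move=> /andP[sr rt]; rewrite -p2s; apply: is_derive0_cst => // q /andP[sq qr].
    by apply: ex_p2; apply: in01; rewrite sq (le_trans qr).
  have sqt : s < q < t by rewrite sq (lt_le_trans qr).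
  by have [] := Hamilton (in01' _ sqt) (gn0 _ sqt).
have dXY j r : s < r < t -> is_derive r 1 (X j) 0 /\ is_derive r 1 (Y j) 0.
  move=> srt; have [d1 d2 _ _] := Hamilton (in01' _ srt) (gn0 _ srt).
  apply: is_derive_rot_eq0 => //; apply: is_derive_eq (d2 j) _.
  rewrite p2E; first by field.
  by case/andP: srt => ? ?; rewrite !ltW.
split=> [|j|j]; first by apply: p2E; rewrite st lexx.
  by apply: is_derive0_cst => // r rst; [exact/ex_X/in01|exact: (dXY _ _ rst).1].
by apply: is_derive0_cst => // r rst; [exact/ex_Y/in01|exact: (dXY _ _ rst).2].
Qed.

Let cst_Z (c : 'rV[R]_n) (s t : R) : 0 < s -> s <= t -> t < 1 ->
  (forall r, s < r < t -> (g r).1 != 0) ->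
  (forall r, s < r < t -> [/\ p2 r = 2 * b, forall j, X j r = x 0 j &
    forall j, Y j r = c 0 j]) -> Z c t = Z c s.
Proof.
move=> s0 st t1 gn0 XY.
have in01 r : s <= r <= t -> 0 < r < 1.
  by move=> /andP[sr rt]; rewrite (lt_le_trans s0)//= (le_lt_trans rt).
apply: is_derive0_cst => // r rst; first exact/ex_Z/in01.
have r01 : 0 < r < 1 by case/andP: rst => ? ?; apply: in01; rewrite !ltW.
have [_ _ d1 _] := Hamilton r01 (gn0 _ rst).
have /is_derive_pairP[_ /= d2] := is_derive_geod x b c r.
have [p2r Xr Yr] := XY _ rst.
have gE : (g r).1 = (geod x b c r).1.
  apply/rowP => j; rewrite geod_fst !mxE -Xr -Yr.
  exact: (rotK b (g1 j) (p1 j) r).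
apply: is_derive_eq (is_deriveB d1 d2) _.
by rewrite -gE p2r; field.
Qed.

Let good_closed (c : 'rV[R]_n) (T : R) : 0 < T < 1 -> (forall t, 0 < t < T -> good c t) -> good c T.
Proof.
move=> T01 gT.
have lim_eq (f : R -> R) y : derivable f T 1 -> (forall t, 0 < t < T -> f t = y) ->
    f T = y.
  move=> /derivable_continuous fT fy.
  have fl : f t @[t --> T^'-] --> f T by exact: cvg_at_left_filter.
  apply: (cvg_unique _ fl); first exact: Rhausdorff.
  apply: cvg_near_cst; near=> t; apply: fy; apply/andP; split.
    by near: t; apply: nbhs_left_gt; case/andP: T01.
  by near: t; exact: nbhs_left_lt.
split=> [|j|j|].
- by apply: lim_eq => [|t /gT[]//]; exact: ex_p2.
- by apply: lim_eq => [|t /gT[]//]; exact: ex_X.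
- by apply: lim_eq => [|t /gT[]//]; exact: ex_Y.
- by apply: lim_eq => [|t /gT[]//]; exact: ex_Z.
Unshelve. all: by end_near. Qed.

Let good_open (c : 'rV[R]_n) (T : R) : 0 < T < 1 -> (forall t, 0 < t <= T -> good c t) ->
  exists2 d, 0 < d & forall t, T < t < T + d -> good c t.
Proof.
move=> T01 gT; have /andP[T0 T1] := T01.
have [p2T XT YT ZT] : good c T by apply: gT; rewrite T0 lexx.
have [e e0 ge] : exists2 e, 0 < e & forall t, T < t < T + e -> (g t).1 != 0.
  have [gT0|] := eqVneq (g T).1 0; last first.
    move=> /rV0Pn[j gTj].
    have [e e0 He] := neq0_right (derivable_continuous (ex_g1 (j := j) T01)) gTj.
    exists e => // t /He gt; apply: contra_neq gt => /rowP/(_ j).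
    by rewrite mxE.
  have [j xj] : exists j, x 0 j != 0 by apply/rV0Pn.
  have gTj : g1 j T = 0 by rewrite /g1 gT0 mxE.
  (* Where [g1 j] vanishes, [X j] reduces to [- sinc * p1 j / 2]; its value [x 0 j] is nonzero, so
     the velocity [p1 j / 2] is too, and the zero is isolated on the right. *)
  have pTj : geod_velocity x b c T 0 j != 0.
    rewrite /geod_velocity !mxE -XT -YT -rotK'.
    move: xj; rewrite -XT /X /rot0 gTj mulr0 sub0r oppr_eq0 mulf_eq0 negb_or.
    by case/andP.
  have /is_derive_pairP[/(_ j) dA _] := is_derive_geod x b c T.
  have dg := derivableP (ex_g1 (j := j) T01).
  have E : 'D_1 (g1 j) T = geod_velocity x b c T 0 j.
    apply: (is_derive_left_eq T0 dg dA) => t tT.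
    by rewrite /g1 (good_geod (gT _ tT)).
  rewrite E in dg.
  have [e e0 He] := is_derive_neq0_right dg pTj gTj.
  exists e => // t /He gt; apply: contra_neq gt => /rowP/(_ j).
  by rewrite mxE.
exists (Num.min e (1 - T)); first by rewrite lt_min e0 subr_gt0.
move=> t /andP[Tt]; rewrite -ltrBlDl lt_min => /andP[te t1].
have XY r : T < r < t + 0 \/ r = t -> [/\ p2 r = 2 * b, forall j, X j r = x 0 j &
    forall j, Y j r = c 0 j].
  move=> rt; have [Tr rt'] : T < r /\ r <= t.
    by case: rt => [/andP[? ?]|->]//; split=> //; lra.
  have [|||q /andP[Tq qr]|//|p2r Xr Yr] := @cst_interval T r.
  - by [].
  - exact: ltW.
  - lra.
  - by apply: ge; rewrite Tq; lra.
  - by split=> // j; rewrite ?Xr ?Yr.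
have [p2t Xt Yt] := XY t (or_intror erefl).
split=> //; rewrite -ZT; apply: cst_Z => //; first exact: ltW; first lra.
  by move=> q /andP[Tq qt]; apply: ge; rewrite Tq; lra.
by move=> q qt; apply: XY; left; rewrite addr0.
Qed.

Lemma geodesic_eq_geod_momentum (d : R) : 0 < d -> d < 1 ->
  (forall t : R, 0 < t < d -> (g t).1 != 0) -> p2 (d / 2) = 2 * b ->
  exists c, {in `[0, 1], g =1 geod x b c}.
Proof.
move=> d0 d1 gd p2b.
(* The equations hold only inside ]0, 1[, so the initial data of the model are read off at the
   interior time [d / 2]. Letting the time tend to 0 then identifies [xx] with [x]. *)
pose xx := \row_i rot0 b (g1 i) (p1 i) (d / 2).
pose c := \row_i rot1 b (g1 i) (p1 i) (d / 2).
have d2 : 0 < d / 2 by rewrite divr_gt0.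
have p2d t : 0 < t < d -> p2 t = 2 * b.
  have cst s r : 0 < s -> s <= r -> r < d -> p2 s = p2 r.
    move=> s0 sr rd; apply/esym; apply: is_derive0_cst => // q /andP[sq qr].
      by apply: ex_p2; apply/andP; split; lra.
    have q01 : 0 < q < 1 by apply/andP; split; lra.
    by have [] // := Hamilton q01; apply: gd; apply/andP; split; lra.
  move=> /andP[t0 td]; rewrite -p2b.
  have [td2|/ltW td2] := leP t (d / 2); first by apply: cst => //; lra.
  by apply/esym/cst => //; lra.
have XYd t : 0 < t < d -> (forall i, rot0 b (g1 i) (p1 i) t = xx 0 i) /\
    (forall i, rot1 b (g1 i) (p1 i) t = c 0 i).
  move=> /andP[t0 td].
  have [td2|/ltW td2] := leP t (d / 2).
    have [|r /andP[tr rd]||_ H1 H2] := @cst_interval t (d / 2) t0 td2.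
    - lra.
    - by apply: gd; apply/andP; split; lra.
    - by apply: p2d; rewrite t0.
    - by split=> i; rewrite mxE; apply/esym; [exact: H1|exact: H2].
  have [|r /andP[tr rd]||_ H1 H2] := @cst_interval (d / 2) t d2 td2.
  - lra.
  - by apply: gd; apply/andP; split; lra.
  - by [].
  - by split=> i; rewrite mxE; [exact: H1|exact: H2].
clearbody xx c.
pose A := geod xx b c.
have gA t : 0 < t < d -> (g t).1 = (A t).1.
  move=> td; have [Xt Yt] := XYd _ td.
  apply/rowP => i; rewrite geod_fst !mxE -Xt -Yt.
  exact: (rotK b (g1 i) (p1 i) t).
have A_lim e : 0 < e -> exists2 d, 0 < d & forall t, 0 <= t -> t < d -> t <= 1 ->
    `|A t - (xx, 0)| < e.
  move=> e0; have [d' d'0 Hd] := abs_continuous01_le (abs_continuous01_geod xx b c) e0.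
  exists d' => // t t0 td t1; rewrite -(geod0 xx b c).
  by apply: Hd => //; rewrite subr0.
have xxE : xx = x.
  apply/rowP => i; apply/eqP; rewrite -subr_eq0 -normr_le0.
  apply/ler_addgt0Pl => e e0; rewrite addr0.
  have e2 : 0 < e / 2 by rewrite divr_gt0.
  have [d1' d1'0 H1] := g_lim e2; have [d2' d2'0 H2] := A_lim _ e2.
  pose t := Num.min (d / 2) (Num.min (d1' / 2) (d2' / 2)).
  have [t0 td td1 td2] : [/\ 0 < t, t <= d / 2, t <= d1' / 2 & t <= d2' / 2].
    by rewrite /t !lt_min !ge_min !lexx !orbT d2 !divr_gt0.
  have {}H1 := H1 t; have {}H2 := H2 t.
  have n1 : `|(g t).1 0 i - x 0 i| < e / 2.
    have := norm_fst_le (g t - (x, 0)) i; rewrite !mxE /= => /le_lt_trans; apply.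
    by apply: H1; lra.
  have n2 : `|(A t).1 0 i - xx 0 i| < e / 2.
    have := norm_fst_le (A t - (xx, 0)) i; rewrite !mxE /= => /le_lt_trans; apply.
    by apply: H2; lra.
  have : (g t).1 = (A t).1 by apply: gA; apply/andP; split; lra.
  move=> E; rewrite E in n1; apply: ltW.
  move: n1 n2; rewrite !ltr_norml => /andP[? ?] /andP[? ?].
  by apply/andP; split; lra.
have AE : A = geod x b c by rewrite /A xxE.
exists c.
(* The difference is constant on ]0, d[, and both terms tend to 0 at time 0. *)
have Zd t : 0 < t < d -> g2 t - (geod x b c t).2 = 0.
  move=> td; have /andP[t0 td'] := td.
  have cst s : 0 < s <= t -> g2 t - (geod x b c t).2 = g2 s - (geod x b c s).2.
    move=> /andP[s0 st]; apply: (@cst_Z c s t) => //; first lra.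
      by move=> r /andP[sr rt]; apply: gd; apply/andP; split; lra.
    move=> r /andP[sr rt].
    have rd : 0 < r < d by apply/andP; split; lra.
    have [Xr Yr] := XYd _ rd.
    by split=> [|i|i]; [exact: p2d|rewrite -xxE; exact: Xr|exact: Yr].
  apply/eqP; rewrite -normr_le0.
  apply/ler_addgt0Pl => e e0; rewrite addr0.
  have e2 : 0 < e / 2 by rewrite divr_gt0.
  have [d1' d1'0 H1] := g_lim e2; have [d2' d2'0 H2] := A_lim _ e2.
  pose s := Num.min t (Num.min (d1' / 2) (d2' / 2)).
  have [s0 sd sd1 sd2] : [/\ 0 < s, s <= t, s <= d1' / 2 & s <= d2' / 2].
    by rewrite /s !lt_min !ge_min !lexx !orbT t0 !divr_gt0.
  have {}H1 := H1 s; have {}H2 := H2 s.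
  have n1 : `|(g s).2| < e / 2.
    have := norm_snd_le (g s - (x, 0)); rewrite /= subr0 => /le_lt_trans; apply.
    by apply: H1; lra.
  have n2 : `|(A s).2| < e / 2.
    have := norm_snd_le (A s - (xx, 0)); rewrite /= subr0 => /le_lt_trans; apply.
    by apply: H2; lra.
  rewrite (cst s); last by rewrite s0.
  rewrite AE in n2; rewrite (le_trans (ler_normB _ _))// /g2.
  by move: n1 n2; lra.
have gE t : 0 < t < 1 -> g t = geod x b c t.
  move=> t01; apply: good_geod.
  move: t t01; apply: real_induction.
  - exists d => // t; rewrite add0r => td; have [Xt Yt] := XYd _ td.
    by split=> [|i|i|]; [exact: p2d|rewrite -xxE; exact: Xt|exact: Yt|exact: Zd].
  - exact: good_closed.
  - exact: good_open.
(* The identity reaches time 1 by continuity of both curves. *)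
have lim1 (h : R -> 'rV[R]_n * R) e : abs_continuous01 h -> 0 < e ->
    exists2 d, 0 < d & forall t, 0 < t < 1 -> 1 - t < d -> `|h 1 - h t| < e.
  move=> hac e0; have [d' d'0 Hd] := abs_continuous01_le hac e0.
  by exists d' => // t /andP[t0 t1] td; apply: Hd => //; lra.
move=> t; rewrite in_itv/= => /andP[].
rewrite le_eqVlt => /predU1P[<- _|t0]; first by rewrite g0 geod0.
rewrite le_eqVlt => /predU1P[->|t1]; last by rewrite gE// t0.
apply/eqP; rewrite -subr_eq0 -normr_le0.
apply/ler_addgt0Pl => e e0; rewrite addr0.
have e2 : 0 < e / 2 by rewrite divr_gt0.
have [d1' d1'0 H1] := lim1 _ _ gac e2.
have [d2' d2'0 H2] := lim1 _ _ (abs_continuous01_geod x b c) e2.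
pose s := Num.min (1 / 2) (Num.min (d1' / 2) (d2' / 2)).
have [s0 sd sd1 sd2] : [/\ 0 < s, s <= 1 / 2, s <= d1' / 2 & s <= d2' / 2].
  by rewrite /s !lt_min !ge_min !lexx !orbT !divr_gt0.
have s01 : 0 < 1 - s < 1 by apply/andP; split; lra.
have {}H1 : `|g 1 - geod x b c (1 - s)| < e / 2.
  by rewrite -(gE _ s01); apply: H1 => //; rewrite subKr; lra.
have {}H2 : `|geod x b c 1 - geod x b c (1 - s)| < e / 2.
  by apply: H2 => //; rewrite subKr; lra.
move: (g 1) (geod x b c 1) (geod x b c (1 - s)) H1 H2 => y z w H1 H2.
have -> : y - z = (y - w) - (z - w) by rewrite opprB addrA subrK.
apply: (le_trans (ler_normB _ _)).
move: `|y - w| `|z - w| H1 H2 => p q; lra.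
Qed.

End constant_momentum.

Lemma geodesic_eq_geod : exists b c, {in `[0, 1], g =1 geod x b c}.
Proof.
have [j xj] : exists j, x 0 j != 0 by apply/rV0Pn.
have [d [d0 d1 gd]] : exists d, [/\ 0 < d, d < 1 & forall t, 0 < t < d -> (g t).1 != 0].
  have xj0 : 0 < `|x 0 j| by rewrite normr_gt0.
  have [d d0 Hd] := g_lim xj0.
  exists (Num.min d (1 / 2)); split; first by rewrite lt_min d0; lra.
    by rewrite gt_min; apply/orP; right; lra.
  move=> t; rewrite lt_min => /and3P[t0 td t2].
  have := Hd t (ltW t0) td; have t1 : t <= 1 by lra.
  move=> /(_ t1); apply: contraTneq => gt0.
  rewrite -leNgt; apply: le_trans (norm_fst_le _ j).
  by rewrite /= gt0 !mxE sub0r normrN.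
have [|c gc] := @geodesic_eq_geod_momentum (p2 (d / 2) / 2) d d0 d1 gd.
  by field.
by exists (p2 (d / 2) / 2), c.
Qed.

End geodesic_uniqueness.

(** * A calibration bounds the length of horizontal curves from below *)


Section cousin.
Context {R : realType}.

(** Cousin's lemma in inductive form. Each step passes over an interval [s, t] that contains its tag
    [T], which is what the following straddle estimate requires. *)
Lemma cousin_induction (V : R -> Prop) (a b : R) : a <= b -> V a ->
  (forall T, a <= T <= b -> exists2 r, 0 < r & forall s t,
     T - r < s -> s <= T -> T <= t -> t < T + r -> a <= s -> t <= b ->
     V s -> V t) ->
  V b.
Proof.
move=> ab Va Vloc; pose S := [set t | a <= t <= b /\ V t].
have Sa : S a by rewrite /S/= lexx.
have hS : has_sup S by split; [exists a|exists b => t [/andP[]]].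
pose T := sup S.
have aT : a <= T by apply: ub_le_sup => //; exact: hS.2.
have Tb : T <= b by apply: ge_sup; [exists a|move=> t [/andP[]]].
have [|r r0 Vr] := Vloc T; first by rewrite aT.
have [s [/andP[as_ sb] Vs] rs] := sup_adherent r0 hS; rewrite -/T in rs.
have sT : s <= T by apply: ub_le_sup; [exact: hS.2|rewrite /S/= as_].
pose t := Num.min b (T + r / 2).
have r2 : 0 < r / 2 by rewrite divr_gt0.
have Tt : T <= t by rewrite le_min Tb lerDl ltW.
have tb : t <= b by rewrite ge_min lexx.
have tr : t < T + r by rewrite gt_min; apply/orP; right; lra.
have Vt : V t by apply: (Vr s).
have : t <= T.
  by apply: ub_le_sup; [exact: hS.2|rewrite /S/= tb (le_trans aT)].
rewrite /t ge_min => /orP[bT|]; last by rewrite gerDl leNgt r2.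
by move: Vt; rewrite /t min_l// (le_trans bT)// lerDl ltW.
Qed.

(** Straddle estimate: the linear approximation at [T] errs by at most [e * (t - T)] on the right
    and [e * (T - s)] on the left, and these add up to [e * (t - s)]. *)
Lemma derivable_le_increment (H : R -> R) (T e : R) : 0 < e ->
  derivable H T 1 -> 'D_1 H T <= 0 ->
  exists2 r, 0 < r & forall s t, T - r < s -> s <= T -> T <= t -> t < T + r ->
    H t - H s <= e * (t - s).
Proof.
move=> e0 dH H0; have /derivableP/is_deriveP/cvgrPdist_le := dH.
move=> /(_ e e0)[r /= r0 Hr]; exists r => // s t Ts sT Tt tT.
have incr q : `|q| < r -> `|H (q + T) - H T - q * 'D_1 H T| <= e * `|q|.
  have [->|q0] := eqVneq q 0; first by rewrite add0r subrr mul0r subrr normr0 mulr0.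
  move=> qr; have /= := Hr q; rewrite sub0r normrN => /(_ qr q0).
  rewrite [q *: 1]mulr1 distrC -(ler_pM2r (x := `|q|)) ?normr_gt0// -normrM.
  by rewrite mulrBl [_ *: _]mulrC mulfVK// (mulrC ('D_1 H T)).
have := incr (t - T); rewrite subrK ger0_norm ?subr_ge0// ltrBlDl.
move=> /(_ tT); rewrite ler_norml => /andP[_ H1].
have := incr (s - T); rewrite subrK ler0_norm ?subr_le0// opprB ltrBlDl -ltrBlDr.
move=> /(_ Ts); rewrite ler_norml => /andP[H2 _].
move: ('D_1 H T) H0 H1 H2 => D H0 H1 H2.
have : (t - T) * D <= 0 by rewrite mulr_ge0_le0 ?subr_ge0.
have : 0 <= (s - T) * D by rewrite mulr_le0 ?subr_le0.
lra.
Qed.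

End cousin.

Section abs_continuous_decreasing.
Context {R : realType} {n : nat}.
Local Notation mu := (@lebesgue_measure R).

Lemma disjoint_itv_measure_le (U : set R) (k : nat) (a b : nat -> R) :
  measurable U -> (forall i, (i < k)%N -> a i <= b i) ->
  (forall i, (i < k)%N -> `]a i, b i[ `<=` U) ->
  trivIset [set: 'I_k] (fun i => `]a i, b i[%classic) ->
  ((\sum_(i < k) (b i - a i))%:E <= mu U)%E.
Proof.
move=> mU ab abU tab.
have -> : (\sum_(i < k) (b i - a i))%:E = mu (\big[setU/set0]_(i < k) `]a i, b i[%classic).
  rewrite measure_semi_additive_ord//=; last exact: bigsetU_measurable.
  rewrite -sumEFin; apply: eq_bigr => i _.
  rewrite lebesgue_measure_itv/= lte_fin; case: ltP => //.
  move=> ba; have -> : b i = a i by apply/eqP; rewrite eq_le ba ab.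
  by rewrite subrr.
rewrite le_measure ?inE//; first exact: bigsetU_measurable.
rewrite -(bigcup_mkord k (fun i => `]a i, b i[%classic)) => t [i /= ik].
exact: abU.
Qed.

(** The bad times lie in an open set [U] of measure less than [d]. Intervals tagged in [U] are
    charged to the absolute continuity of [g], the others to the straddle estimate; each kind costs
    at most [e / 2]. *)
Lemma ae_derive_le0 (g : R -> 'rV[R]_n * R) (H : R -> R) C : 0 <= C ->
  abs_continuous01 g ->
  (forall s t, 0 <= s -> s <= t -> t <= 1 -> H t - H s <= C * `|g t - g s|) ->
  {ae mu, forall t : R, 0 < t < 1 -> derivable H t 1 /\ 'D_1 H t <= 0} ->
  H 1 <= H 0.
Proof.
move=> C0 gac HC [N [mN N0 badN]].
apply/ler_addgt0Pl => e e0.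
have e2 : 0 < e / 2 by rewrite divr_gt0.
have [d d0 Hd] := gac (e / 2 / (C + 1)) (divr_gt0 e2 (ltr_wpDl C0 ltr01)).
have m01 : measurable ([set 0] `|` [set 1] : set R).
  by apply: measurableU; exact: measurable_set1.
(* The endpoints join the null set because the derivative is only known in ]0, 1[. *)
pose N' := N `|` ([set 0] `|` [set 1]).
have mN' : measurable N' by exact: measurableU.
have N'0 : mu N' = 0%E.
  apply/negligibleP => //; apply: negligibleU; first by exists N; split.
  by apply: negligibleU; apply/negligibleP => //; exact: lebesgue_measure_set1.
have [U [oU NU muU]] : exists U : set R, [/\ open U, N' `<=` U & (mu U < d%:E)%E].
  have N'oo : (mu N' < +oo)%E by rewrite N'0.
  have [U [oU NU muU]] := lebesgue_regularity_outer mN' N'oo d0.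
  exists U; split=> //.
  have mU : measurable U by exact: open_measurable.
  rewrite (_ : U = (U `\` N') `|` N'); last by rewrite setUC setDUK.
  rewrite measureU//; last first.
  - by rewrite setDE -setIA setICl setI0.
  - exact: measurableD.
  by rewrite [X in (_ + X)%E](_ : _ = 0%E) ?adde0.
(* The intervals ]a i, b i[ are those tagged in [U] so far; the remaining part of [0, t] is paid for
   by [e / 2 * t]. *)
pose V t := exists (k : nat) (a b : nat -> R),
  [/\ forall i, (i < k)%N -> [/\ 0 <= a i, a i <= b i & b i <= t],
      forall i j, (i < j)%N -> (j < k)%N -> b i <= a j,
      forall i, (i < k)%N -> `]a i, b i[ `<=` U &
      H t - H 0 <= e / 2 * t + C * \sum_(i < k) `|g (b i) - g (a i)|].
have : V 1.
  apply: (@cousin_induction R V 0 1) => //.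
    exists 0%N, (fun=> 0), (fun=> 0); split => //.
    by rewrite subrr mulr0 big_ord0 mulr0 addr0.
  move=> T /andP[T0 T1].
  have [TU|nTU] := pselect (U T).
    have /nbhs_ballP[r /= r0 rU] : nbhs T U by exact: open_nbhs_nbhs.
    exists r => // s t Ts sT Tt tT s0 t1 [k [a [b [ab dab abU Hs]]]].
    exists k.+1, (fun i => if i == k then s else a i), (fun i => if i == k then t else b i).
    split.
    - move=> i; rewrite ltnS leq_eqVlt; case: eqVneq => [-> _|_ /= ik].
        by split => //; exact: le_trans Tt.
      by have [? ? ?] := ab i ik; split => //; rewrite (le_trans _ Tt)// (le_trans _ sT).
    - move=> i j ij jk; rewrite (_ : (i == k) = false); last first.
        by apply/negbTE; rewrite neq_ltn (leq_trans ij).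
      move: jk; rewrite ltnS leq_eqVlt; case: eqVneq => [jE _|_ /= jk].
        by have [|_ _ ->] := ab i; rewrite -?jE.
      exact: dab.
    - move=> i; rewrite ltnS leq_eqVlt; case: eqVneq => [-> _|_ /= ik]; last exact: abU.
      move=> q /=; rewrite in_itv/= => /andP[sq qt]; apply: rU.
      by rewrite /ball/= ltr_norml; apply/andP; split; lra.
    - rewrite big_ord_recr/= eqxx.
      rewrite (eq_bigr (fun i : 'I_k => `|g (b i) - g (a i)|)); last first.
        by move=> i _; rewrite (ltn_eqF (ltn_ord i)).
      rewrite mulrDr.
      have := HC s t s0 (le_trans sT Tt) t1.
      have : e / 2 * s <= e / 2 * t by rewrite ler_pM2l// (le_trans sT).
      move: (e / 2 * s) (e / 2 * t) (C * \sum_(i < k) _) (C * `|_|) Hs.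
      by move=> p q v w; lra.
  have T01 : 0 < T < 1.
    rewrite !lt_neqAle T0 T1 !andbT; apply/andP; split.
      by apply/eqP => E; apply: nTU; apply: NU; right; left; rewrite -E.
    by apply/eqP => E; apply: nTU; apply: NU; right; right; rewrite -E.
  have [dH H0] : derivable H T 1 /\ 'D_1 H T <= 0.
    apply: contrapT => bad; apply: nTU; apply: NU; left; apply: badN.
    by move=> /= /(_ T01).
  have [r r0 Hr] := derivable_le_increment e2 dH H0.
  exists r => // s t Ts sT Tt tT s0 t1 [k [a [b [ab dab abU Hs]]]].
  exists k, a, b; split => //.
    move=> i ik; have [? ? bs] := ab i ik; split=> //.
    by rewrite (le_trans bs)// (le_trans sT).
  have := Hr s t Ts sT Tt tT; rewrite mulrBr.
  move: (e / 2 * s) (e / 2 * t) (C * \sum_(i < k) _) Hs.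
  by move=> p q v; lra.
case=> k [a [b [ab dab abU H1]]].
have tab : trivIset [set: 'I_k] (fun i => `]a i, b i[%classic).
  move=> i j _ _ [q [/=]]; rewrite !in_itv/= => /andP[aiq qbi] /andP[ajq qbj].
  apply/val_inj; have [ij|ji|//] := ltngtP i j.
    by have := lt_trans ajq qbi; rewrite ltNge (dab _ _ ij (ltn_ord j)).
  by have := lt_trans aiq qbj; rewrite ltNge (dab _ _ ji (ltn_ord i)).
have sd : \sum_(i < k) (b i - a i) < d.
  rewrite -lte_fin; apply: le_lt_trans muU.
  apply: disjoint_itv_measure_le => //; first exact: open_measurable.
  by move=> i ik; have [] := ab i ik.
have := Hd k (fun i => a i) (fun i => b i) (fun i => ab i (ltn_ord i)) tab sd.
rewrite ltr_pdivlMr ?ltr_wpDl// => sum_lt.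
have S0 : 0 <= \sum_(i < k) `|g (b i) - g (a i)| by exact: sumr_ge0.
move: H1 sum_lt S0; move: (\sum_(i < k) _) => S H1 sum_lt S0.
by nra.
Qed.

End abs_continuous_decreasing.

Section calibration.
Context {R : realType} {n : nat}.

(* Completing squares, with [w] the reparametrized time derivative: times [w],
   the left-hand side is [- |v.1 - a w p.1|^2 - (v.2 / |p.1| - b w |p.1|)^2]. *)
Lemma calibration_le0 (p v : 'rV[R]_n * R) (a b L w : R) : 0 < L ->
  horizontal_vector p v -> w = speed p v / L ->
  2 * b * v.2 - (b ^+ 2 + a ^+ 2) * w * dot p.1 p.1 + 2 * a * dot p.1 v.1
    - L ^+ 2 * w <= 0.
Proof.
move=> L0 /horizontal_vectorP pv wE.
have d0 := dot_ge0 p.1; have r0 := dot_ge0 v.1.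
have s0 : 0 <= dot v.1 v.1 + v.2 ^+ 2 / dot p.1 p.1.
  by rewrite addr_ge0// divr_ge0// sqr_ge0.
have w0 : 0 <= w by rewrite wE divr_ge0// ?sqrtr_ge0// ltW.
have w2 : L ^+ 2 * w ^+ 2 = dot v.1 v.1 + v.2 ^+ 2 / dot p.1 p.1.
  rewrite wE exprMn sqr_sqrtr// exprVn mulrCA mulfV ?mulr1//.
  by rewrite expf_eq0/= gt_eqF.
have V0 : dot p.1 p.1 = 0 -> v.2 = 0.
  by move=> /eqP; rewrite dot_eq0 => /eqP /pv.
have sq : 0 <= dot v.1 v.1 - 2 * (a * w) * dot p.1 v.1 + (a * w) ^+ 2 * dot p.1 p.1.
  have := dot_ge0 (v.1 + (- (a * w)) *: p.1).
  rewrite !(dotDl, dotDr, dotZl, dotZr) (dotC v.1 p.1).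
  by move: (dot _ _) (dot _ _) (dot _ _) (a * w) => x y z t; lra.
have v1 : dot v.1 v.1 = 0 -> dot p.1 v.1 = 0.
  by move=> /eqP; rewrite dot_eq0 => /eqP ->; rewrite dot0r.
move: (dot p.1 p.1) (dot v.1 v.1) (dot p.1 v.1) v.2 d0 r0 s0 w2 V0 sq v1.
move=> d r q y d0 r0 s0 w2 V0 sq v1.
have sq2 : 0 <= y ^+ 2 / d - 2 * b * y * w + b ^+ 2 * w ^+ 2 * d.
  have [dE|dn0] := eqVneq d 0; first by rewrite V0// dE; lra.
  have -> : y ^+ 2 / d - 2 * b * y * w + b ^+ 2 * w ^+ 2 * d = (y - b * w * d) ^+ 2 / d.
    by field.
  by rewrite divr_ge0// sqr_ge0.
(* The sum of squares appears only after multiplication by [w]. If [w = 0], the speed is zero and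
   every term vanishes. *)
move: w0; rewrite le_eqVlt => /predU1P[w0|w0].
  rewrite -w0 in w2 *; rewrite expr0n/= mulr0 in w2.
  have yd0 : 0 <= y ^+ 2 / d by rewrite divr_ge0// sqr_ge0.
  have rE : r = 0 by lra.
  have yE : y ^+ 2 / d = 0 by lra.
  have -> : y = 0.
    have [/V0//|dn0] := eqVneq d 0.
    by move: yE => /eqP; rewrite mulf_eq0 invr_eq0 (negPf dn0) orbF expf_eq0/= => /eqP.
  by rewrite v1//; lra.
rewrite -(pmulr_rle0 _ w0).
have -> : w * (2 * b * y - (b ^+ 2 + a ^+ 2) * w * d + 2 * a * q - L ^+ 2 * w) =
  2 * b * y * w - (b ^+ 2 + a ^+ 2) * w ^+ 2 * d + 2 * (a * w) * q - L ^+ 2 * w ^+ 2.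
  by ring.
by rewrite w2; move: (y ^+ 2 / d) sq sq2 => z; lra.
Qed.

End calibration.

(** * Measurability of the speed *)

Section measurability.
Context {R : realType}.
Local Notation mu := (@lebesgue_measure R).

Lemma measurable_derive (G : R -> R) (E : set R) : continuous G ->
  (forall t : R, E t -> derivable G t 1) ->
  measurable_fun E (fun t => 'D_1 G t).
Proof.
move=> cG dG.
apply: (@measurable_fun_cvg _ _ _ E
  (fun k t => (harmonic k)^-1 * (G (harmonic k + t) - G t))) => [k|t Et].
  apply: measurable_funS (@subsetT _ E) _ => //.
  apply: continuous_measurable_fun => t.
  apply: cvgM; first exact: cvg_cst.
  apply: cvgB; last exact: cG.
  apply: (cvg_comp (fun s => harmonic k + s) G); last exact: cG.
  by apply: cvgD; [exact: cvg_cst|exact: cvg_id].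
have /derivableP/is_deriveP/cvgr_dnbhsP := dG t Et.
move=> /(_ (@harmonic R)) H.
have : (harmonic k)^-1 *: (G (harmonic k *: 1 + t) - G t) @[k --> \oo] --> 'D_1 G t.
  apply: H; split; last exact: cvg_harmonic.
  by move=> k; rewrite gt_eqF//= invr_gt0.
apply: cvg_trans; apply: near_eq_cvg; near=> k.
by rewrite [harmonic k *: 1]mulr1.
Unshelve. all: by end_near. Qed.

(** Taken directly from the integral as a supremum over simple functions, since the integrand of
    [clength] is not known to be measurable. *)
Lemma ge0_le_integral_restrict (f g : R -> \bar R) (D1 D2 : set R) :
  (forall t, (0 <= f t)%E) -> (forall t, (0 <= g t)%E) ->
  (forall t, ((f \_ D1) t <= (g \_ D2) t)%E) ->
  (\int[mu]_(t in D1) f t <= \int[mu]_(t in D2) g t)%E.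
Proof.
move=> f0 g0 fg; rewrite !ge0_integralE//.
apply: ereal_sup_le => _ [h hf <-].
by exists h => // t; apply: le_trans (fg t); exact: hf.
Qed.

End measurability.

Section clamp.
Context {R : realType} {n : nat}.
Implicit Types (g : R -> 'rV[R]_n * R) (s t : R).

(** Curves are arbitrary outside [0, 1]; composing with the clamp makes them continuous on the whole
    line, as [measurable_derive] demands. *)
Definition clamp01 t : R := Num.max 0 (Num.min t 1).

Lemma clamp01_itv t : 0 <= clamp01 t <= 1.
Proof. by rewrite /clamp01 le_max lexx ge_max ler01 ge_min lexx orbT. Qed.

Lemma clamp01_id t : 0 <= t <= 1 -> clamp01 t = t.
Proof. by move=> /andP[t0 t1]; rewrite /clamp01 min_l// max_r. Qed.

Lemma clamp01_le s t : s <= t ->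
  clamp01 s <= clamp01 t /\ clamp01 t - clamp01 s <= t - s.
Proof.
move=> st; rewrite /clamp01 !maxEle !minEle.
case: (leP s 1) => ?; case: (leP t 1) => ?; rewrite ?ler01;
  do 2?[case: ifPn => [|/negP/negP]; rewrite -?ltNge => ?]; split; lra.
Qed.

Lemma continuous_clamp01 g (phi : 'rV[R]_n * R -> R) : abs_continuous01 g ->
  (forall p q, `|phi p - phi q| <= `|p - q|) ->
  continuous (fun t => phi (g (clamp01 t))).
Proof.
move=> gac phi1 t; apply/cvgrPdist_lt => e e0.
have [d d0 Hd] := abs_continuous01_le gac e0.
have H s r : s <= r -> r - s < d -> `|phi (g (clamp01 r)) - phi (g (clamp01 s))| < e.
  move=> sr srd; apply: (le_lt_trans (phi1 _ _)).
  have [c1 c2] := clamp01_le sr.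
  have /andP[? _] := clamp01_itv s; have /andP[_ ?] := clamp01_itv r.
  by apply: Hd => //; apply: le_lt_trans srd.
near=> s.
have : `|t - s| < d by near: s; apply: cvgr_dist_lt.
have [st|/ltW ts] := leP s t.
  by rewrite ger0_norm ?subr_ge0// => /H; apply.
by rewrite ler0_norm ?subr_le0// opprB distrC => /H; apply.
Unshelve. all: by end_near. Qed.

Lemma fst_dist_le (p q : 'rV[R]_n * R) j : `|p.1 0 j - q.1 0 j| <= `|p - q|.
Proof. by have := norm_fst_le (p - q) j; rewrite !mxE. Qed.

Lemma snd_dist_le (p q : 'rV[R]_n * R) : `|p.2 - q.2| <= `|p - q|.
Proof. exact: (norm_snd_le (p - q)). Qed.

Lemma abs_continuous01_bounded g : abs_continuous01 g ->
  exists2 B, 0 <= B & forall t, 0 <= t <= 1 -> `|g t| <= B.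
Proof.
move=> gac.
have cN := continuous_clamp01 gac (fun p q => ler_dist_dist p q).
have [c _ Hc] := EVT_max (@ler01 R) (continuous_subspaceT cN).
exists `|g (clamp01 c)| => // t t01.
by have := Hc t; rewrite in_itv/= clamp01_id// => ->.
Qed.

Lemma near_clamp01 t : 0 < t < 1 -> \forall s \near t, clamp01 s = s.
Proof.
move=> /andP[t0 t1]; near=> s; apply: clamp01_id; apply/andP; split; apply: ltW.
  by near: s; exact: lt_nbhsr.
by near: s; exact: lt_nbhsl.
Unshelve. all: by end_near. Qed.

Lemma measurable_derive_comp g (phi : 'rV[R]_n * R -> R) (E : set R) :
  abs_continuous01 g ->
  (forall p q, `|phi p - phi q| <= `|p - q|) ->
  (forall t, E t -> 0 < t < 1 /\ derivable (fun s => phi (g s)) t 1) ->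
  measurable E ->
  measurable_fun E (fun t => phi (g t)) /\
  measurable_fun E (fun t => 'D_1 (fun s => phi (g s)) t).
Proof.
move=> gac phi1 dphi mE; have cG := continuous_clamp01 gac phi1.
have nearE t : E t -> \forall s \near t, phi (g s) = phi (g (clamp01 s)).
  by move=> /dphi[/near_clamp01 + _]; apply: filterS => s ->.
split.
  apply: (@eq_measurable_fun _ _ _ _ E (fun t => phi (g (clamp01 t)))).
    move=> t; rewrite inE => Et; have [/andP[t0 t1] _] := dphi _ Et.
    by rewrite clamp01_id// !ltW.
  by apply: measurable_funS (@subsetT _ E) _ => //; exact: continuous_measurable_fun.
apply: (@eq_measurable_fun _ _ _ _ E
    (fun t => 'D_1 (fun s => phi (g (clamp01 s))) t)).
  move=> t; rewrite inE => Et; apply/esym.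
  by apply: near_eq_derive; exact: nearE.
apply: measurable_derive => // t Et.
apply: near_eq_derivable (nearE _ Et) _.
by have [] := dphi _ Et.
Qed.

Lemma measurable_speed g (E : set R) : abs_continuous01 g -> measurable E ->
  (forall t, E t -> 0 < t < 1 /\ derivable g t 1) ->
  measurable_fun E (fun t => speed (g t) ('D_1 g t)).
Proof.
move=> gac mE dg.
have dP t : E t -> (forall j, is_derive t 1 (fun s => (g s).1 0 j) (('D_1 g t).1 0 j)) /\
    is_derive t 1 (fun s => (g s).2) ('D_1 g t).2.
  by move=> /dg[_ /derivableP/is_derive_pairP].
have m1 j : measurable_fun E (fun t => (g t).1 0 j) /\
    measurable_fun E (fun t => ('D_1 g t).1 0 j).
  have [||//|M1 M2] := @measurable_derive_comp g (fun p => p.1 0 j) E gac.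
  - by move=> p q; exact: fst_dist_le.
  - move=> t Et; split; first by have [] := dg _ Et.
    by have [d _] := dP _ Et; have dj := d j; exact: ex_derive.
  split=> //; apply: eq_measurable_fun M2 => t; rewrite inE => Et.
  by have [d _] := dP _ Et; have dj := d j; exact: derive_val.
have m2 : measurable_fun E (fun t => ('D_1 g t).2).
  have [||//|_ M2] := @measurable_derive_comp g snd E gac.
  - by move=> p q; exact: snd_dist_le.
  - move=> t Et; split; first by have [] := dg _ Et.
    by have [_ d] := dP _ Et; exact: ex_derive.
  apply: eq_measurable_fun M2 => t; rewrite inE => Et.
  by have [_ d] := dP _ Et; exact: derive_val.
have -> : (fun t => speed (g t) ('D_1 g t)) = fun t =>
    (dot ('D_1 g t).1 ('D_1 g t).1 +
     ('D_1 g t).2 ^+ 2 * (dot (g t).1 (g t).1) `^ (- 1)) `^ (2^-1).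
  apply/funext => t; rewrite powR_inv1 ?dot_ge0// powR12_sqrt//.
  by rewrite addr_ge0 ?dot_ge0// divr_ge0 ?sqr_ge0 ?dot_ge0.
apply: (measurableT_comp (f := fun z : R => z `^ 2^-1)).
  exact: measurable_powR.
apply: measurable_funD.
  apply: measurable_sum => j; apply: measurable_funM; exact: (m1 j).2.
apply: measurable_funM; first exact: measurable_funX.
apply: (measurableT_comp (f := fun z : R => z `^ (- 1))).
  exact: measurable_powR.
by apply: measurable_sum => j; apply: measurable_funM; exact: (m1 j).1.
Qed.

End clamp.

(** * Arc length and the lower bound for the length *)

Section arc_length.
Context {R : realType} {n : nat}.
Local Notation mu := (@lebesgue_measure R).

Lemma arc_length_exists (g : R -> 'rV[R]_n * R) (L : R) :
  horizontal_curve g -> 0 < L -> (clength g < L%:E)%E ->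
  exists th : R -> R,
    [/\ forall t, 0 <= th t <= 1, {homo th : s t / s <= t} &
        {ae mu, forall t : R, 0 < t < 1 ->
          [/\ derivable g t 1, horizontal_vector (g t) ('D_1 g t) &
              is_derive t 1 th (speed (g t) ('D_1 g t) / L)]}].
Proof.
move=> [gac [N [mN N0 badN]]] L0 gL.
pose E := `]0, 1[%classic `\` N.
have mE : measurable E by exact: measurableD.
have goodE t : E t -> [/\ 0 < t < 1, derivable g t 1 &
    horizontal_vector (g t) ('D_1 g t)].
  rewrite /E/= in_itv/= => -[t01 nNt]; split => //.
    apply: contrapT => bad; apply: nNt; apply: badN => /= H.
    by apply: bad; case: H => //; rewrite in_itv/=; case/andP: t01 => ? ?; rewrite !ltW.
  apply: contrapT => bad; apply: nNt; apply: badN => /= H.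
  by apply: bad; case: H => //; rewrite in_itv/=; case/andP: t01 => ? ?; rewrite !ltW.
(* Extended by 0 off the good times, the speed is measurable on the line and its integral is at most
   [clength g]. *)
pose v := (fun t => speed (g t) ('D_1 g t)) \_ E.
have v0 t : 0 <= v t by rewrite /v patchE; case: ifP => // _; exact: sqrtr_ge0.
have mv : measurable_fun setT v.
  apply: ((measurable_restrictT (fun t => speed (g t) ('D_1 g t)) mE).1).
  apply: measurable_speed => // t Et.
  by have [] := goodE _ Et.
have v_le : (\int[mu]_(t in setT) (v t)%:E <= clength g)%E.
  apply: ge0_le_integral_restrict => t; first by rewrite lee_fin.
    exact: hnorm_ge0.
  rewrite patch_setT [in leRHS]patchE; case: ifPn => t01.
    rewrite /v patchE; case: ifPn => [|_]; last exact: hnorm_ge0.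
    by rewrite inE => /goodE[_ _ hor]; rewrite hnormE.
  rewrite /v patchE ifF//; apply/negbTE; apply: contraNN t01.
  rewrite !inE => /goodE[/andP[t0 t1] _ _] /=.
  by rewrite in_itv/= !ltW.
have iv : mu.-integrable setT (EFin \o v).
  apply/integrableP; split; first exact/measurable_EFinP.
  apply: le_lt_trans (lt_trans (le_lt_trans v_le gL) (ltry _)).
  apply: ge0_le_integral_restrict => t; [exact: abse_ge0|by rewrite lee_fin|].
  by rewrite !patch_setT /= ger0_norm.
have ivy y : mu.-integrable [set` Interval (BLeft 0) (BRight y)] (EFin \o v).
  exact: integrableS iv.
pose F t := (\int[mu]_(s in [set` Interval (BLeft 0) (BRight t)]) v s)%R.
have FE t : (F t)%:E = (\int[mu]_(s in `[0%R, t]) (v s)%:E)%E.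
  by rewrite /F /Rintegral fineK//; exact: integrable_fin_num.
have Fmono s t : s <= t -> F s <= F t.
  move=> st; rewrite -lee_fin !FE; apply: ge0_subset_integral => //.
  - by apply/measurable_EFinP; exact: measurable_funS mv.
  - by move=> r _; rewrite lee_fin.
  - by apply: subset_itvl; rewrite bnd_simp.
have F0 t : 0 <= F t by apply: Rintegral_ge0.
have FL t : F t <= L.
  rewrite -lee_fin FE; apply: le_trans (ltW gL); apply: le_trans v_le.
  apply: ge0_subset_integral => //; first exact/measurable_EFinP.
  by move=> r _; rewrite lee_fin.
exists (fun t => F t / L); split.
- move=> t; apply/andP; split; first by rewrite divr_ge0// ltW.
  by rewrite ler_pdivrMr// mul1r.
- move=> s t st; by rewrite ler_pM2r ?invr_gt0// Fmono.
have aeF := FTC1 ivy (open_integrable_locally openT iv).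
have aeN : {ae mu, forall t, ~ N t}.
  by exists N; split => // t /= /contrapT.
apply: (@filterS2 _ _ (ae_filter_ringOfSetsType mu) _ _ _ _ aeF aeN).
move=> t Ft nNt t01.
have Et : E t by rewrite /E/= in_itv/=.
have [_ dg hor] := goodE _ Et; split=> //.
have [] := Ft; first by rewrite lte_fin; case/andP: t01.
move=> dF; rewrite derive1E => F'.
have dF' : is_derive t 1 F (v t) by rewrite -F'; exact: derivableP.
have -> : speed (g t) ('D_1 g t) = v t by rewrite /v patchE mem_set.
by der; rewrite /= mulr0 add0r mulrC.
Qed.


Lemma is_derive_dot (g : R -> 'rV[R]_n * R) (t : R) v : is_derive t 1 g v ->
  is_derive t 1 (fun s => dot (g s).1 (g s).1) (2 * dot (g t).1 v.1).
Proof.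
move=> /is_derive_pairP[dg _].
have d j : is_derive t 1 (fun s => (g s).1 0 j * (g s).1 0 j)
    ((g t).1 0 j * v.1 0 j + (g t).1 0 j * v.1 0 j).
  by have := dg j => dj; der.
have := is_derive_sum d; rewrite (_ : \sum_(j < n) _ = fun s => dot (g s).1 (g s).1).
  move=> dS; apply: is_derive_eq dS _.
  by rewrite big_split/= -mulr2n mulr_natl.
by rewrite fct_sumE.
Qed.

Lemma dot_dist_le (p q : 'rV[R]_n * R) B : `|p| <= B -> `|q| <= B ->
  dot p.1 p.1 - dot q.1 q.1 <= n%:R * (2 * B) * `|p - q|.
Proof.
move=> pB qB; rewrite /dot -sumrB.
have -> : n%:R * (2 * B) * `|p - q| = \sum_(j < n) 2 * B * `|p - q|.
  by rewrite sumr_const card_ord -mulrA mulr_natl.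
apply: ler_sum => j _.
have -> : p.1 0 j * p.1 0 j - q.1 0 j * q.1 0 j =
  (p.1 0 j + q.1 0 j) * (p.1 0 j - q.1 0 j) by ring.
rewrite (le_trans (ler_norm _))// normrM ler_pM//; last exact: fst_dist_le.
rewrite (le_trans (ler_normD _ _))// mulr2n mulrDl mul1r lerD//.
  exact: le_trans (norm_fst_le _ _) pB.
exact: le_trans (norm_fst_le _ _) qB.
Qed.

(* [riccati b] solves [a' = - b^2 - a^2] on [0, 1], with [a 1 = - a 0]. It is the
   logarithmic derivative of [cos (b (s - 1/2))], the first component of
   the minimizing geodesic. *)
Definition riccati (b s : R) : R := - b * tan (b * (s - 1 / 2)).

Lemma is_derive_riccati (b s : R) : 0 < b < pi -> 0 <= s <= 1 ->
  is_derive s 1 (riccati b) (- (b ^+ 2 + riccati b s ^+ 2)).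
Proof.
move=> /andP[b0 bpi] /andP[s0 s1].
have c0 : cos (b * (s - 1 / 2)) != 0.
  by rewrite gt_eqF// cos_gt0_pihalf//; apply/andP; split; nra.
rewrite /riccati /tan; der => //.
by field: (sin2cos2 (b * (s - 1 / 2))).
Qed.

Lemma riccati_nincr (b s t : R) : 0 < b < pi -> 0 <= s -> s <= t -> t <= 1 ->
  riccati b t <= riccati b s.
Proof.
move=> bpi s0; rewrite le_eqVlt => /predU1P[->//|st] t1.
have d r : s <= r <= t -> is_derive r 1 (riccati b) (- (b ^+ 2 + riccati b r ^+ 2)).
  move=> /andP[sr rt]; apply: is_derive_riccati => //.
  by rewrite (le_trans s0)// (le_trans rt).
have [r _] := MVT_is_derive st d.
move=> E; rewrite -subr_le0 E mulr_le0_ge0 ?subr_ge0 ?(ltW st)//.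
by rewrite oppr_le0 addr_ge0 ?sqr_ge0.
Qed.

Lemma riccati0 b : riccati b 0 = b * tan (b / 2).
Proof. by rewrite /riccati sub0r mulrN tanN mulrNN mul1r. Qed.

Lemma riccati1 b : riccati b 1 = - (b * tan (b / 2)).
Proof.
by rewrite /riccati (_ : b * (1 - 1 / 2) = b / 2) ?mulNr//; field.
Qed.

Lemma clength_lower_bound (g : R -> 'rV[R]_n * R) (x : 'rV[R]_n) (u b L : R) :
  horizontal_curve g -> connects (x, 0) (x, u) g -> 0 < b < pi -> 0 < L ->
  (clength g < L%:E)%E ->
  2 * b * u - 2 * dot x x * b * tan (b / 2) <= L ^+ 2.
Proof.
move=> hg [g0 g1] bpi L0 gL; have [gac _] := hg; have /andP[b0 _] := bpi.
have [th [th01 thmono aeth]] := arc_length_exists hg L0 gL.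
have [B B0 HB] := abs_continuous01_bounded gac.
pose A s := riccati b (th s).
pose q s := dot (g s).1 (g s).1.
pose H s := 2 * b * (g s).2 + A s * q s - L ^+ 2 * th s.
have Amono s t : s <= t -> A t <= A s.
  have /andP[s0 _] := th01 s; have /andP[_ t1] := th01 t.
  by move=> /thmono st; exact: riccati_nincr.
have A_le s : `|A s| <= riccati b 0.
  have /andP[t0 t1] := th01 s.
  rewrite ler_norml riccati_nincr// andbT.
  by rewrite riccati0 -riccati1 riccati_nincr.
have A0 : 0 <= riccati b 0 by apply: le_trans (A_le 0).
pose C := 2 * b + riccati b 0 * (n%:R * (2 * B)).
have C0 : 0 <= C.
  apply: addr_ge0; first by rewrite mulr_ge0// ltW.
  by rewrite mulr_ge0// mulr_ge0// mulr_ge0.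
(* Split [A t * q t - A s * q s] as [A t * (q t - q s) + (A t - A s) * q s]: the last term and the
   one in [th] are nonpositive by monotonicity. *)
have HC s t : 0 <= s -> s <= t -> t <= 1 -> H t - H s <= C * `|g t - g s|.
  move=> s0 st t1.
  have gs : `|g s| <= B by apply: HB; rewrite s0 (le_trans st).
  have gt : `|g t| <= B by apply: HB; rewrite t1 (le_trans s0).
  have h1 : (g t).2 - (g s).2 <= `|g t - g s|.
    by apply: le_trans (ler_norm _) (snd_dist_le _ _).
  have h2 : A t * (q t - q s) <= riccati b 0 * (n%:R * (2 * B) * `|g t - g s|).
    apply: le_trans (ler_norm _) _; rewrite normrM ler_pM//.
    rewrite ler_norml dot_dist_le// andbT lerNl opprB distrC.
    exact: dot_dist_le.
  have h3 : (A t - A s) * q s <= 0.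
    by rewrite mulr_le0_ge0 ?subr_le0 ?Amono// dot_ge0.
  have h4 : 0 <= L ^+ 2 * (th t - th s).
    by rewrite mulr_ge0 ?sqr_ge0// subr_ge0 thmono.
  have h5 : b * ((g t).2 - (g s).2) <= b * `|g t - g s| by rewrite ler_pM2l.
  rewrite /H /C; lra.
have aeH : {ae mu, forall t : R, 0 < t < 1 -> derivable H t 1 /\ 'D_1 H t <= 0}.
  apply: (@filterS _ _ (ae_filter_ringOfSetsType mu) _ _ _ aeth) => t Ht t01.
  have [dg hor dth] := Ht t01.
  have /is_derive_pairP[_ d2] := derivableP dg.
  have dq := is_derive_dot (derivableP dg).
  have dA : is_derive t 1 A (- (b ^+ 2 + A t ^+ 2) * (speed (g t) ('D_1 g t) / L)).
    have dr := is_derive_riccati bpi (th01 t).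
    exact: (is_derive1_comp (f := riccati b) (g := th)).
  have dH : is_derive t 1 H (2 * b * ('D_1 g t).2
      - (b ^+ 2 + A t ^+ 2) * (speed (g t) ('D_1 g t) / L) * q t
      + 2 * A t * dot (g t).1 ('D_1 g t).1 - L ^+ 2 * (speed (g t) ('D_1 g t) / L)).
    by rewrite /H; der; rewrite /q; ring.
  split; first exact: ex_derive.
  by rewrite derive_val; exact: calibration_le0.
have := ae_derive_le0 C0 gac HC aeH; rewrite /H /q g0 g1/= mulr0 add0r.
have /andP[t00 t01] := th01 0; have /andP[t10 t11] := th01 1.
(* The values [th 0] and [th 1] are only known to lie in [0, 1]; monotonicity of [riccati b] gives
   the inequality in the useful direction at both ends. *)
have a1 : riccati b 1 <= A 1 by apply: riccati_nincr.
have a0 : A 0 <= riccati b 0 by apply: riccati_nincr.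
rewrite riccati1 in a1; rewrite riccati0 in a0.
have xx := dot_ge0 x; have L2 := sqr_ge0 L.
have e1 : - (b * tan (b / 2)) * dot x x <= A 1 * dot x x by rewrite ler_wpM2r.
have e0 : A 0 * dot x x <= b * tan (b / 2) * dot x x by rewrite ler_wpM2r.
have e3 : L ^+ 2 * th 1 <= L ^+ 2 by rewrite ler_piMr.
have e4 : 0 <= L ^+ 2 * th 0 by rewrite mulr_ge0.
lra.
Qed.

End arc_length.

(** * Endpoints and lengths of geodesics *)


Section endpoint.
Context {R : realType} {n : nat}.
Context (x : 'rV[R]_n) (u : R).
Context (x_neq0 : x != 0) (u_gt0 : 0 < u).
Implicit Types (b : R) (c : 'rV[R]_n) (m : nat).

(** The value of |c| that solves [|c|^2 / (2 b) + |x|^2 b / 2 = u] for [b = 2 m pi]. *)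
Definition loop_radius m : R :=
  2 * Num.sqrt (m%:R * pi * u - (m%:R * pi) ^+ 2 * enorm x ^+ 2).

Lemma loop_radicand_ge0 m : m%:R * pi * enorm x ^+ 2 <= u ->
  0 <= m%:R * pi * u - (m%:R * pi) ^+ 2 * enorm x ^+ 2.
Proof.
move=> mu.
have -> : m%:R * pi * u - (m%:R * pi) ^+ 2 * enorm x ^+ 2 =
  m%:R * pi * (u - m%:R * pi * enorm x ^+ 2) by ring.
by rewrite mulr_ge0 ?subr_ge0// mulr_ge0 ?ler0n ?pi_ge0.
Qed.

Let x2_gt0 : 0 < enorm x ^+ 2.
Proof. by rewrite sqr_enorm dot_gt0. Qed.

Let mu_gt0 : 0 < u / enorm x ^+ 2.
Proof. by rewrite divr_gt0. Qed.

Lemma mu_solution_gt0 b : mu_solution x u b -> 0 < b.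
Proof.
move=> [cb bE]; move: mu_gt0; rewrite bE muhat_gt0//.
by rewrite pmulr_lgt0// invr_gt0.
Qed.

Lemma mu_solution_u b : mu_solution x u b -> u = enorm x ^+ 2 * muhat (b / 2).
Proof. by move=> [_ <-]; rewrite mulrC divfK// gt_eqF. Qed.

Lemma sin_half b : sin b = 2 * (sin (b / 2) * cos (b / 2)).
Proof.
rewrite [in LHS](_ : b = (b / 2) *+ 2); last by rewrite mulr2n -splitr.
by rewrite sin_mulr2n -mulr_natl (mulrC (cos _)).
Qed.

Lemma cos_half b : cos b = 2 * cos (b / 2) ^+ 2 - 1.
Proof.
rewrite [in LHS](_ : b = (b / 2) *+ 2); last by rewrite mulr2n -splitr.
by rewrite cos_mulr2n mulr_natl.
Qed.

Lemma sin_double b : sin (2 * b * 1) = 2 * (sin b * cos b).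
Proof. by rewrite mulr1 mulr_natl sin_mulr2n -mulr_natl (mulrC (cos _)). Qed.

Lemma geodb1 b : b != 0 -> cos (b / 2) != 0 ->
  geodb x b 1 = (x, enorm x ^+ 2 * muhat (b / 2)).
Proof.
move=> b0 cb; have s2 := sin2cos2 (b / 2).
rewrite /geodb [LHS]surjective_pairing; congr pair.
  rewrite geod_fst /sinc (negPf b0) mulr1 scalerA -scalerDl.
  rewrite -[RHS]scale1r; congr (_ *: _).
  rewrite (sin_half b) (cos_half b) /tan; field: s2.
  by rewrite cb.
rewrite /geod (negPf b0)/= sin_double mulr1 dotZr sqr_enorm dotZl dotZr -sqr_enorm.
rewrite (cos_half b) (sin_half b) /muhat /tan; field: s2.
by rewrite b0 cb.
Qed.

Lemma mu_solution_connects b : mu_solution x u b ->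
  connects (x, 0) (x, u) (geodb x b).
Proof.
move=> bs; split; first exact: geod0.
rewrite geodb1 -?mu_solution_u//; first by rewrite gt_eqF// mu_solution_gt0.
by have [] := bs.
Qed.

Lemma geod1_sin0 b c : b != 0 -> sin b = 0 -> cos b = 1 ->
  geod x b c 1 = (x, enorm c ^+ 2 / (2 * b) + enorm x ^+ 2 * b / 2).
Proof.
move=> b0 sb cb; rewrite [LHS]surjective_pairing; congr pair.
  by rewrite geod_fst /sinc (negPf b0) mulr1 sb cb mul0r scale0r scale1r add0r.
by rewrite /geod (negPf b0)/= sin_double mulr1 sb; field.
Qed.

Lemma sin_2mpi m : sin (2 * m%:R * pi) = 0 :> R.
Proof.
by rewrite -[2 * m%:R]natrM mulr_natl -[pi *+ _]add0r
  (alternatingn (@sinDpi R)) sin0 mulr0.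
Qed.

Lemma cos_2mpi m : cos (2 * m%:R * pi) = 1 :> R.
Proof.
by rewrite -[2 * m%:R]natrM mulr_natl -[pi *+ _]add0r
  (alternatingn (@cosDpi R)) cos0 mulr1 exprM sqrrN !expr1n.
Qed.

Lemma loop_connects m c : (1 <= m)%N -> m%:R * pi * enorm x ^+ 2 <= u ->
  enorm c = loop_radius m -> connects (x, 0) (x, u) (geod x (2 * m%:R * pi) c).
Proof.
move=> m1 mu cm; split; first exact: geod0.
have mp : 0 < m%:R * pi :> R by rewrite mulr_gt0 ?ltr0n ?pi_gt0.
have b0 : 2 * m%:R * pi != 0 :> R by rewrite -mulrA mulf_neq0// gt_eqF.
rewrite (geod1_sin0 c b0 (sin_2mpi m) (cos_2mpi m)); congr pair.
rewrite cm /loop_radius exprMn sqr_sqrtr; last first.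
  exact: loop_radicand_ge0.
rewrite -(mulrA 2); move: (m%:R * pi) mp => k k0; field.
by rewrite gt_eqF.
Qed.

Lemma connects_geod b c : connects (x, 0) (x, u) (geod x b c) ->
  (mu_solution x u b /\ c = (b * tan (b / 2)) *: x) \/
  exists m, [/\ (1 <= m)%N, m%:R * pi * enorm x ^+ 2 <= u,
    enorm c = loop_radius m & b = 2 * m%:R * pi].
Proof.
move=> [_ g1].
have [b0|b0] := eqVneq b 0.
  by move: g1; rewrite /geod b0 eqxx => -[_ /eqP]; rewrite lt_eqF.
have := congr1 fst g1; rewrite geod_fst /sinc (negPf b0) mulr1/= => g11.
have [sb|sb] := eqVneq (sin b) 0; last first.
  left.
  have cb : cos (b / 2) != 0.
    by apply: contra_neq sb; rewrite (sin_half b) => ->; rewrite !mulr0.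
  have sb2 : sin (b / 2) != 0.
    by apply: contra_neq sb; rewrite (sin_half b) => ->; rewrite mul0r mulr0.
  have cE : c = (b * tan (b / 2)) *: x.
    have : (sin b / b) *: c = (1 - cos b) *: x.
      by rewrite scalerBl scale1r -{1}g11 addrK.
    move=> /(congr1 (fun v => (b / sin b) *: v)); rewrite !scalerA.
    rewrite (_ : b / sin b * (sin b / b) = 1); last by field; rewrite b0 sb.
    rewrite scale1r => ->; congr (_ *: _).
    rewrite (cos_half b) (sin_half b) /tan; field: (sin2cos2 (b / 2)).
    by rewrite cb sb2.
  split=> //; split=> //.
  move: g1; rewrite cE -/(geodb x b) geodb1// => -[<-].
  by rewrite mulrC mulKf// gt_eqF.
right.
(* With [sin b = 0] the horizontal endpoint condition loses [c] and reads [cos b *: x = x]. *)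
have cb : cos b = 1.
  move: g11; rewrite sb mul0r scale0r add0r => /eqP.
  rewrite -subr_eq0 -[X in _ - X]scale1r -scalerBl scaler_eq0 (negPf x_neq0) orbF.
  by rewrite subr_eq0 => /eqP.
move: g1; rewrite geod1_sin0// => -[uE].
have {}uE : enorm c ^+ 2 + enorm x ^+ 2 * b ^+ 2 = 2 * b * u.
  by rewrite -uE; field.
(* By [uE], [2 b u] is a sum of squares, positive since [x] and [b] are nonzero. *)
have b_gt0 : 0 < b.
  have : 0 < 2 * b * u.
    rewrite -uE ltr_wpDl ?sqr_ge0// mulr_gt0//.
    by rewrite exprn_even_gt0.
  by rewrite pmulr_lgt0// pmulr_rgt0.
have [k bk] := sin_eq0_gt0 b_gt0 sb.
have ek : ~~ odd k.
  apply/negP => ok; move: cb.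
  rewrite bk mulr_natl -[pi *+ _]add0r (alternatingn (@cosDpi R)) cos0 mulr1.
  rewrite -signr_odd ok expr1 => /eqP; rewrite eq_sym -subr_eq0 opprK.
  by rewrite (_ : 1 + 1 = 2%:R :> R)// pnatr_eq0.
have bE : b = 2 * (k./2)%:R * pi.
  by rewrite bk -[in LHS](odd_double_half k) (negPf ek) add0n -muln2 natrM (mulrC _ 2).
move: (k./2) bE => m bE; exists m.
have m1 : (1 <= m)%N.
  by rewrite lt0n; apply/eqP => m0; move: b0; rewrite bE m0 mulr0 mul0r eqxx.
have mp : 0 < m%:R * pi :> R by rewrite mulr_gt0 ?ltr0n ?pi_gt0.
have cE : enorm c ^+ 2 =
    2 ^+ 2 * (m%:R * pi * u - (m%:R * pi) ^+ 2 * enorm x ^+ 2).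
  have -> : enorm c ^+ 2 = 2 * b * u - enorm x ^+ 2 * b ^+ 2 by rewrite -uE addrK.
  by rewrite bE; ring.
split=> //.
  have : 0 <= (m%:R * pi) * (u - m%:R * pi * enorm x ^+ 2) *+ 4.
    by rewrite (_ : _ *+ 4 = enorm c ^+ 2) ?sqr_ge0// cE; ring.
  by rewrite pmulrn_lge0// pmulr_rge0// subr_ge0.
rewrite /loop_radius -[LHS]ger0_norm ?enorm_ge0// -sqrtr_sqr cE sqrtrM//.
by rewrite sqrtr_sqr ger0_norm.
Qed.

Lemma clength_geodb b g : cos (b / 2) != 0 -> {in `[0, 1], g =1 geodb x b} ->
  clength g = (Num.sqrt (b ^+ 2 / cos (b / 2) ^+ 2 * enorm x ^+ 2))%:E.
Proof.
move=> cb gE; rewrite (clength_geod gE) !sqr_enorm dotZl dotZr -!sqr_enorm.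
congr (Num.sqrt _)%:E; rewrite /tan; field: (sin2cos2 (b / 2)).
exact: cb.
Qed.

Lemma clength_geodb_sqr b : cos (b / 2) != 0 ->
  (clength (geodb x b) ^+ 2)%E = (b ^+ 2 / cos (b / 2) ^+ 2 * enorm x ^+ 2)%:E.
Proof.
move=> cb; rewrite (clength_geodb cb)// -EFin_expe sqr_sqrtr//.
by rewrite mulr_ge0 ?sqr_ge0// divr_ge0 ?sqr_ge0.
Qed.

Lemma mu_solution_sqr_length b : mu_solution x u b ->
  b ^+ 2 / cos (b / 2) ^+ 2 * enorm x ^+ 2 =
  2 * b * u - 2 * enorm x ^+ 2 * b * tan (b / 2).
Proof.
move=> bs; have [cb _] := bs.
by rewrite [in RHS](mu_solution_u bs) /muhat; field.
Qed.

Lemma clength_geodb_lt b1 b2 : mu_solution x u b1 -> mu_solution x u b2 ->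
  b1 < b2 -> b1 ^+ 2 / cos (b1 / 2) ^+ 2 * enorm x ^+ 2 <
    b2 ^+ 2 / cos (b2 / 2) ^+ 2 * enorm x ^+ 2.
Proof.
move=> s1 s2 b12; rewrite ltr_pM2r//.
have [c1 e1] := s1; have [c2 e2] := s2; have b1_gt0 := mu_solution_gt0 s1.
have := @sqr_div_cos2_lt R (b1 / 2) (b2 / 2) _ _ c1 c2.
rewrite divr_gt0// ltr_pM2r ?invr_gt0// -e1 -e2 => /(_ isT b12 erefl).
rewrite !exprMn ![_ * 2^-1 ^+ 2 / _]mulrAC ltr_pM2r//.
Qed.

Lemma clength_loop m c g : m%:R * pi * enorm x ^+ 2 <= u ->
  enorm c = loop_radius m -> {in `[0, 1], g =1 geod x (2 * m%:R * pi) c} ->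
  clength g = (2 * Num.sqrt (m%:R * pi * u))%:E.
Proof.
move=> mu cm gE; rewrite (clength_geod gE) cm /loop_radius exprMn sqr_sqrtr; last first.
  exact: loop_radicand_ge0.
have -> : 2 ^+ 2 * (m%:R * pi * u - (m%:R * pi) ^+ 2 * enorm x ^+ 2) +
  (2 * m%:R * pi) ^+ 2 * enorm x ^+ 2 = 2 ^+ 2 * (m%:R * pi * u) by ring.
by rewrite sqrtrM// sqrtr_sqr ger0_norm.
Qed.

Lemma loop_index_bound m : m%:R * pi * enorm x ^+ 2 <= u ->
  (m < (Num.truncn (u / (pi * enorm x ^+ 2))).+1)%N.
Proof.
move=> mu; have p0 : 0 < pi * enorm x ^+ 2 by rewrite mulr_gt0 ?pi_gt0.
by rewrite ltnS -[leqLHS](@natrK R m) le_truncn// ler_pdivlMr// mulrA.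
Qed.

Lemma finite_mu_solution : finite_set [set b | mu_solution x u b].
Proof.
apply: (@sub_finite_set _ _ ((fun s => 2 * s) @`
  [set s | [/\ 0 < s, cos s != 0 & muhat s = u / enorm x ^+ 2]])); last first.
  exact/finite_image/finite_muhat_level.
move=> b bs; exists (b / 2); last by field.
have [cb bE] : mu_solution x u b by [].
by split=> //; rewrite divr_gt0// (mu_solution_gt0 bs).
Qed.

Lemma geodesic_classification (g : R -> 'rV[R]_n * R) :
  is_geodesic g -> connects (x, 0) (x, u) g ->
  (exists2 b, mu_solution x u b & {in `[0, 1], g =1 geodb x b}) \/
  (exists m c, [/\ (1 <= m)%N, m%:R * pi * enorm x ^+ 2 <= u,
     enorm c = loop_radius m & {in `[0, 1], g =1 geod x (2 * m%:R * pi) c}]).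
Proof.
move=> [[gac _] [P gP]] [g0 g1].
have [b [c gE]] := geodesic_eq_geod x_neq0 g0 gac gP.
have : connects (x, 0) (x, u) (geod x b c).
  by split; [exact: geod0|rewrite -gE// in_itv/= ler01 lexx].
move=> /connects_geod[[bs cE]|[m [m1 mu cm bE]]].
  by left; exists b => // t t01; rewrite gE// cE.
by right; exists m, c; split=> // t t01; rewrite gE// bE.
Qed.

Lemma mu_solution_exists : exists b, 0 < b < pi /\ mu_solution x u b.
Proof.
have [s [s0 sp cs sE]] := muhat_surj mu_gt0.
exists (2 * s); rewrite /mu_solution (_ : 2 * s / 2 = s); last by field.
by split; [apply/andP; split; lra|split].
Qed.

Lemma mu_solution_inj b1 b2 : 0 < b1 < pi -> 0 < b2 < pi ->
  mu_solution x u b1 -> mu_solution x u b2 -> b1 = b2.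
Proof.
move=> /andP[? ?] /andP[? ?] [_ e1] [_ e2].
suff : b1 / 2 = b2 / 2 by lra.
apply: muhat_inj; last by rewrite -e1 -e2.
  by apply/andP; split; lra.
by apply/andP; split; lra.
Qed.

End endpoint.

(** * The distance and the classification of connecting geodesics *)

Section distance.
Context {R : realType} {n : nat}.

Lemma eq_patch01 (g h : R -> 'rV[R]_n * R) : {in `[0, 1], g =1 h} ->
  g \_ `[0%R, 1%R]%classic = h \_ `[0%R, 1%R]%classic.
Proof.
move=> gh; apply/funext => t; rewrite !patchE; case: ifPn => //.
by rewrite inE/= => /gh.
Qed.

(** In dimension one the sphere of admissible [c] has at most two points, so each [m] contributes
    finitely many curves. *)
Lemma enorm_rV1 (c : 'rV[R]_n) : n = 1%N ->
  c = enorm c *: const_mx 1 \/ c = - enorm c *: const_mx 1.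
Proof.
move=> n1; subst n.
have -> : enorm c = `|c 0 0| by rewrite /enorm /dot big_ord1 -expr2 sqrtr_sqr.
have cE a : a = c 0 0 -> c = a *: const_mx 1.
  by move=> aE; apply/rowP => j; rewrite !mxE mulr1 aE (ord1 j).
have [c0|c0] := leP 0 (c 0 0); [left|right]; apply: cE.
  by rewrite ger0_norm.
by rewrite ltr0_norm// opprK.
Qed.

Context (x : 'rV[R]_n) (u : R).
Context (x_neq0 : x != 0) (u_gt0 : 0 < u).

Lemma dCC_geodb b : 0 < b < pi -> mu_solution x u b ->
  dCC (x, 0) (x, u) = clength (geodb x b).
Proof.
move=> bpi bs; have [cb bE] := bs; have [b0 bp] := andP bpi.
apply/eqP; rewrite eq_le; apply/andP; split.
  apply: ereal_inf_lbound; exists (geodb x b); split => //.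
    by have [] := is_geodesic_geod x b ((b * tan (b / 2)) *: x).
  exact: mu_solution_connects.
apply: le_ereal_inf_tmp => _ [g [hg cg ->]].
rewrite leNgt; apply/negP.
rewrite (clength_geodb cb (fun t _ => erefl (geodb x b t))).
set l := Num.sqrt _ => gl.
have l2 : l ^+ 2 = 2 * b * u - 2 * dot x x * b * tan (b / 2).
  rewrite sqr_sqrtr; last by rewrite mulr_ge0 ?sqr_ge0// divr_ge0 ?sqr_ge0.
  by rewrite (mu_solution_sqr_length x_neq0 bs) sqr_enorm.
have g_ge0 : (0 <= clength g)%E by apply: integral_ge0 => t _; exact: hnorm_ge0.
have g_fin : clength g \is a fin_num.
  by rewrite ge0_fin_numE//; apply: lt_trans gl _; exact: ltry.
move: gl g_ge0; rewrite -(fineK g_fin) lte_fin lee_fin.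
set k := fine _ => kl k0.
(* The midpoint is strictly above the length [k], as the lower bound requires, and strictly below
   [l], which gives the contradiction. *)
have L0 : 0 < (k + l) / 2 by lra.
have gL : (clength g < ((k + l) / 2)%:E)%E.
  by rewrite -(fineK g_fin) -/k lte_fin; lra.
have := clength_lower_bound hg cg bpi L0 gL.
rewrite -l2 ler_sqr ?nnegrE; lra.
Qed.

End distance.

Theorem theorem2p4 (R : realType) (n : nat) (x : 'rV[R]_n) (u : R)
    (x_neq0 : x != 0) (u_gt0 : 0 < u) :
  let rad (m : nat) : R :=
    2 * Num.sqrt (m%:R * pi * u - (m%:R * pi) ^+ 2 * enorm x ^+ 2) in
  (* If n >= 2 and u > pi |x|^2, the vectors c with |c| = rad 1 form a sphere, so
     that the set of curves is infinite although the values of b and of the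
     length are finitely many. *)
  [/\ (forall g : R -> 'rV[R]_n * R,
        is_geodesic g -> connects (x, 0) (x, u) g ->
        (exists2 b : R, mu_solution x u b & {in `[0, 1], g =1 geodb x b}) \/
        (exists (m : nat) (c : 'rV[R]_n),
          [/\ (1 <= m)%N, m%:R * pi * enorm x ^+ 2 <= u, enorm c = rad m &
              {in `[0, 1], g =1 geod x (2 * m%:R * pi) c}])),
      finite_set [set b : R | exists c : 'rV[R]_n,
        is_geodesic (geod x b c) /\ connects (x, 0) (x, u) (geod x b c)],
      finite_set [set l : \bar R | exists g : R -> 'rV[R]_n * R,
        [/\ is_geodesic g, connects (x, 0) (x, u) g & l = clength g]] &
      (n = 1%N \/ u <= pi * enorm x ^+ 2 ->
        finite_set [set g \_ `[0%R, 1%R]%classic | g in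
          [set g : R -> 'rV[R]_n * R |
            is_geodesic g /\ connects (x, 0) (x, u) g]])]
  /\
  ((forall b : R, mu_solution x u b ->
      [/\ is_geodesic (geodb x b),
          connects (x, 0) (x, u) (geodb x b),
          (clength (geodb x b) ^+ 2)%E
            = (b ^+ 2 / cos (b / 2) ^+ 2 * enorm x ^+ 2)%:E &
          (clength (geodb x b) ^+ 2)%E
            = (2 * b * u - 2 * enorm x ^+ 2 * b * tan (b / 2))%:E]) /\
   (forall b1 b2 : R, mu_solution x u b1 -> mu_solution x u b2 -> b1 < b2 ->
      (clength (geodb x b1) ^+ 2 < clength (geodb x b2) ^+ 2)%E))
  /\
  (enorm x ^+ 2 * pi <= u ->
    forall m : nat, (1 <= m)%N -> m%:R * pi * enorm x ^+ 2 <= u ->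
      (exists c : 'rV[R]_n, enorm c = rad m) /\
      (forall c : 'rV[R]_n, enorm c = rad m ->
        [/\ is_geodesic (geod x (2 * m%:R * pi) c),
            connects (x, 0) (x, u) (geod x (2 * m%:R * pi) c) &
            clength (geod x (2 * m%:R * pi) c)
              = (2 * Num.sqrt (m%:R * pi * u))%:E]))
  /\
  (exists b : R,
    [/\ 0 < b < pi /\ mu_solution x u b,
        (forall b' : R, 0 < b' < pi -> mu_solution x u b' -> b' = b),
        (forall g : R -> 'rV[R]_n * R,
          is_geodesic g -> connects (x, 0) (x, u) g ->
          (clength (geodb x b) <= clength g)%E /\
          (~ {in `[0, 1], g =1 geodb x b} ->
            (clength (geodb x b) < clength g)%E)),
        dCC (x, 0) (x, u) = clength (geodb x b) &
        dCC (x, 0) (x, u) = (b / cos (b / 2) * enorm x)%:E /\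
        dCC (x, 0) (x, u)
          = (Num.sqrt (2 * b * u - 2 * enorm x ^+ 2 * b * tan (b / 2)))%:E]).

Proof.
move=> rad.
have x2 : 0 < enorm x ^+ 2 by rewrite sqr_enorm dot_gt0.
pose M := (Num.truncn (u / (pi * enorm x ^+ 2))).+1.
have classif := geodesic_classification x_neq0 u_gt0.
have finS := finite_mu_solution x_neq0 u_gt0.
split; last split; last split.
- split.
  + exact: classif.
  + apply: (@sub_finite_set _ _ ([set b | mu_solution x u b] `|`
      (fun m : nat => 2 * m%:R * pi) @` `I_M)); last first.
      by rewrite finite_setU; split=> //; exact: finite_image.
    move=> b [c [_ /(connects_geod x_neq0 u_gt0)[[]|[m [_ mu _ ->]]]]]; first by left.
    by right; exists m => //; exact: loop_index_bound.
  + apply: (@sub_finite_set _ _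
      ((fun b => clength (geodb x b)) @` [set b | mu_solution x u b] `|`
      (fun m : nat => (2 * Num.sqrt (m%:R * pi * u))%:E) @` `I_M)); last first.
      by rewrite finite_setU; split; exact: finite_image.
    move=> l [g [gg gc ->]]; have [[b bs gE]|[m [c [m1 mu cm gE]]]] := classif g gg gc.
      left; exists b; first exact: bs.
      have [cb _] := bs; rewrite (clength_geodb cb gE).
      exact: (clength_geodb cb (fun t _ => erefl (geodb x b t))).
    right; exists m; first exact: loop_index_bound.
    by rewrite (clength_loop mu cm gE).
  + move=> n1u.
    (* One vector [w] serves both hypotheses: the unit vector in dimension one, and 0 when
       [u <= pi |x|^2], where only [m = 1] can occur and its radius is 0. *)
    have [w Hw] : exists w : 'rV[R]_n, forall m c, (1 <= m)%N ->
        m%:R * pi * enorm x ^+ 2 <= u -> enorm c = rad m ->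
        c = (1 * rad m) *: w \/ c = (- 1 * rad m) *: w.
      case: n1u => [n1|ux].
        exists (const_mx 1) => m c _ _ <-; rewrite mul1r mulN1r.
        exact: enorm_rV1.
      exists 0 => m c m1 mu cm; left; rewrite scaler0; apply/eqP.
      rewrite -dot_eq0 -sqr_enorm cm /rad.
      have p0 : 0 < pi * enorm x ^+ 2 by rewrite mulr_gt0 ?pi_gt0.
      have m1' : m = 1%N.
        apply/eqP; rewrite eqn_leq m1 andbT -(ler_nat R).
        by rewrite -(ler_pM2r p0) mul1r mulrA (le_trans mu).
      rewrite m1' in mu *; rewrite !mul1r in mu *.
      have -> : u = pi * enorm x ^+ 2 by apply/eqP; rewrite eq_le ux mu.
      by rewrite mulrA -expr2 subrr sqrtr0 mulr0 expr0n.
    apply: (@sub_finite_set _ _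
      ((fun b => geodb x b \_ `[0%R, 1%R]%classic) @` [set b | mu_solution x u b] `|`
       [set geod x (2 * m%:R * pi) ((e * rad m) *: w) \_ `[0%R, 1%R]%classic |
         m in `I_M & e in [set 1; -1]])); last first.
      rewrite finite_setU; split; first exact: finite_image.
      by apply: finite_image2 => //; exact: finite_set2.
    move=> _ [g [gg gc] <-]; have [[b bs gE]|[m [c [m1 mu cm gE]]]] := classif g gg gc.
      by left; exists b; [exact: bs|apply/esym; exact: eq_patch01].
    right; exists m; first exact: loop_index_bound.
    have [cE|cE] := Hw m c m1 mu cm.
      by exists 1; [left|rewrite -cE; apply/esym; exact: eq_patch01].
    by exists (- 1); [right|rewrite -cE; apply/esym; exact: eq_patch01].
- split=> [b bs|b1 b2 s1 s2 b12].
    have [cb _] := bs; split.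
    + exact: is_geodesic_geod.
    + exact: mu_solution_connects.
    + exact: clength_geodb_sqr.
    + by rewrite (clength_geodb_sqr x cb) (mu_solution_sqr_length x_neq0 bs).
  have [c1 _] := s1; have [c2 _] := s2.
  have lt_EFin (p q : \bar R) (r s : R) :
    p = r%:E -> q = s%:E -> r < s -> (p < q)%E by move=> -> ->; rewrite lte_fin.
  apply: lt_EFin (clength_geodb_sqr x c1) (clength_geodb_sqr x c2) _.
  exact: (clength_geodb_lt x_neq0 u_gt0 s1 s2 b12).
- move=> _ m m1 mu; split=> [|c cm].
    exists ((rad m / enorm x) *: x); rewrite enormZ ger0_norm.
      by rewrite divfK// gt_eqF// enorm_gt0.
    by rewrite divr_ge0 ?enorm_ge0// mulr_ge0// sqrtr_ge0.
  split; first exact: is_geodesic_geod.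
    exact: loop_connects.
  by apply: (clength_loop mu cm) => t _.
have [b [bpi bs]] := mu_solution_exists x_neq0 u_gt0.
have /andP[b0 bp] := bpi; have [cb _] := bs.
have cb0 : 0 < cos (b / 2).
  by apply: cos_gt0_pihalf; apply/andP; split; have := pi_gt0 R; lra.
have lb := clength_geodb cb (fun t _ => erefl (geodb x b t)).
have lb2 := mu_solution_sqr_length x_neq0 bs.
exists b; split; first by split.
- by move=> b' b'pi b's; exact: (mu_solution_inj b'pi bpi b's bs).
- move=> g gg gc.
  suff : (clength (geodb x b) < clength g)%E \/ {in `[0, 1], g =1 geodb x b}.
    case=> [lt|gE]; first by rewrite (ltW lt).
    by rewrite (clength_geodb cb gE) lb lexx; split.
  have [[b' b's gE]|[m [c [m1 mu cm gE]]]] := classif g gg gc.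
    have [b'b|b'b] := eqVneq b' b; first by right; rewrite -b'b.
    left; have [cb' _] := b's; rewrite lb (clength_geodb cb' gE) lte_fin.
    (* All solutions are positive, so one below [b] would lie in ]0, pi[ and equal [b]. *)
    have lt : b < b'.
      rewrite lt_neqAle eq_sym b'b/= leNgt; apply/negP => b'_lt.
      move/eqP: b'b; apply; apply: (mu_solution_inj _ bpi b's bs).
      by rewrite (mu_solution_gt0 x_neq0 u_gt0 b's) (lt_trans b'_lt).
    rewrite ltr_sqrt; first exact: (clength_geodb_lt x_neq0 u_gt0).
    by rewrite mulr_gt0// divr_gt0 ?exprn_even_gt0//= gt_eqF// (lt_trans b0).
  left; rewrite lb (clength_loop mu cm gE) lte_fin lb2.
  (* The squared length [4 m pi u] of a loop is at least [4 pi u], while that of [geodb x b] is at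
     most [2 b u < 2 pi u]. *)
  have -> : 2 * Num.sqrt (m%:R * pi * u) = Num.sqrt (2 ^+ 2 * (m%:R * pi * u)).
    by rewrite [RHS]sqrtrM// sqrtr_sqr ger0_norm.
  have mpi : pi <= m%:R * pi :> R by rewrite ler_peMl ?pi_ge0// ler1n.
  have mpiu : pi * u <= m%:R * pi * u by rewrite ler_pM2r.
  have bu : b * u < pi * u by rewrite ltr_pM2r.
  have pu : 0 < pi * u by rewrite mulr_gt0// pi_gt0.
  have tb : 0 <= 2 * enorm x ^+ 2 * b * tan (b / 2).
    rewrite mulr_ge0//; first by rewrite mulr_ge0 ?(ltW b0)// mulr_ge0// ltW.
    rewrite divr_ge0 ?(ltW cb0)//; apply: sin_ge0_pi.
    by apply/andP; split; have := pi_gt0 R; lra.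
  rewrite ltr_sqrt; first by rewrite expr2; lra.
  by rewrite mulr_gt0//; lra.
- exact: dCC_geodb.
- rewrite (dCC_geodb x_neq0 u_gt0 bpi bs) lb -lb2; split; last by [].
  congr EFin.
  rewrite -expr_div_n -exprMn sqrtr_sqr ger0_norm//.
  by rewrite mulr_ge0 ?enorm_ge0// divr_ge0// ltW.
Qed.
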